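(* Let $\Gamma$ be a finite connected metric graph and let $\Lambda$ be a loop with the same total length as $\Gamma$. Then the positive eigenvalues of the Krein Laplacian $-\Delta_{{\rm K},\Gamma}$ (without potential) satisfy $$\lambda_j^+(-\Delta_{{\rm K},\Gamma})\ge\lambda_j^+(-\Delta_{{\rm st},\Lambda})=\lambda_{j+1}(-\Delta_{{\rm st},\Lambda})$$ for all $j\in\mathbb{N}$.
   Context: A finite metric graph $\Gamma$ consists of a finite vertex set $\mathcal{V}$, a finite nonempty edge set $\mathcal{E}$ (loops and multiple edges allowed) and a length function $\ell:\mathcal{E}\to(0,\infty)$; its total length is $\sum_{e\in\mathcal{E}}\ell(e)$. Each edge $e$ is identified with $[0,\ell(e)]$, its two endpoints corresponding to the (possibly equal) vertices incident with $e$. A loop is a metric graph with one vertex and one edge. A function $f$ on $\Gamma$ is a collection $(f_e)_{e\in\mathcal{E}}$ of functions $f_e:(0,\ell(e))\to\mathbb{C}$; $f\in L^2(\Gamma)$ means $f_e\in L^2(0,\ell(e))$ for all $e$. $\widetilde H^k(\Gamma)$ is the set of $f\in L^2(\Gamma)$ with $f_e\in H^k(0,\ell(e))$ for all $e$; $H^1(\Gamma)$ is the set of $f\in\widetilde H^1(\Gamma)$ that are continuous at each vertex (all traces at endpoints corresponding to the same vertex $v$ coincide; the common value is $f(v)$). For $f\in\widetilde H^2(\Gamma)$ and $v\in\mathcal{V}$, $\partial_\nu f(v)$ is the sum, over all edge endpoints located at $v$ (both endpoints of a loop at $v$ are counted), of the derivative of $f_e$ at that endpoint taken in the direction pointing towards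 $v$ (i.e. $f_e'(\ell(e))$ for the endpoint $\ell(e)$ and $-f_e'(0)$ for the endpoint $0$). Let $S$ be the operator in $L^2(\Gamma)$ with $(Sf)_e=-f_e''$ on each edge and $\operatorname{dom}S=\{f\in\widetilde H^2(\Gamma)\cap H^1(\Gamma): f(v)=\partial_\nu f(v)=0\text{ for each }v\in\mathcal{V}\}$. It is closed, symmetric, densely defined with a positive lower bound; its adjoint $S^*$ acts in the same way on $\operatorname{dom}S^*=\widetilde H^2(\Gamma)\cap H^1(\Gamma)$. The Krein Laplacian $-\Delta_{{\rm K},\Gamma}$ is the Krein–von Neumann extension of $S$: the self-adjoint restriction of $S^*$ to $\operatorname{dom}S\dotplus\ker S^*$. The standard Laplacian $-\Delta_{{\rm st},\Lambda}$ acts as $f\mapsto-f''$ on $\{f\in\widetilde H^2(\Lambda)\cap H^1(\Lambda):\partial_\nu f(v)=0\ \forall v\}$ (periodic boundary conditions). Both have purely discrete nonnegative spectrum; $\lambda_1\le\lambda_2\le\dots$ are the eigenvalues and $\lambda_1^+\le\lambda_2^+\le\dots$ the positive eigenvalues, counted with multiplicities. *)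

(* Defs.v *)
From HB Require Import structures.
From mathcomp Require Import all_boot all_order all_algebra.
From mathcomp Require Import complex.
From mathcomp Require Import all_classical all_reals all_analysis.

Set Implicit Arguments.
Unset Strict Implicit.
Unset Printing Implicit Defensive.
Import Order.TTheory GRing.Theory Num.Theory.
Import numFieldNormedType.Exports.

Local Open Scope classical_set_scope.
Local Open Scope ring_scope.
Local Open Scope complex_scope.

(* The edge e is the interval [0, len e]. The endpoint 0 is located at the
   vertex bd e false, the endpoint len e at bd e true; loops and multiple
   edges are allowed. *)
Record metric_graph (R : realType) := MetricGraph {
  vertex : finType;
  edge : finType;
  len : edge -> R;
  bd : edge -> bool -> vertex;
  len_gt0 : forall e, 0 < len e;
  edge_nonempty : (0 < #|edge|)%N
}.

Section MetricGraphs.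
Context {R : realType}.
Implicit Type G : metric_graph R.

Definition total_length G : R := \sum_(e : edge G) len e.

Definition adjacent G : rel (vertex G) := fun v w =>
  [exists e, exists b, (bd e b == v) && (bd e (~~ b) == w)].

Definition connected_graph G : Prop := forall v w, connect (@adjacent G) v w.

Definition is_loop G : Prop := #|vertex G| = 1%N /\ #|edge G| = 1%N.

End MetricGraphs.

Section Interval.
Context {R : realType}.
Local Notation mu := (@lebesgue_measure R).
Implicit Types (l : R) (f g h u : R -> R[i]).

Definition cintegral (D : set R) f : R[i] :=
  (\int[mu]_(x in D) complex.Re (f x)) +i* (\int[mu]_(x in D) complex.Im (f x)).

Definition L2_on l f : Prop :=
  [/\ measurable_fun `]0, l[ (fun x => complex.Re (f x)),
      measurable_fun `]0, l[ (fun x => complex.Im (f x)) &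
      mu.-integrable `]0, l[ (fun x => (complex.Re (f x) ^+ 2 + complex.Im (f x) ^+ 2)%:E)].

(* u is, on the closed interval [0, l], the absolutely continuous
   representative of an element of H^1(0, l) whose weak derivative is du. *)
Definition H1_rep l u du : Prop :=
  L2_on l du /\
  (forall x, 0 <= x <= l -> u x = u 0 + cintegral `[0, x] du).

(* The same for H^2(0, l): du is the absolutely continuous representative of
   the derivative, so that u 0, u l, du 0, du l are the traces. *)
Definition H2_rep l u du ddu : Prop := H1_rep l u du /\ H1_rep l du ddu.

End Interval.

(* Functions on G are total functions of a real variable on every edge; only
   their values on ]0, len e[ matter, and elements of L^2(G) are compared up to
   equality almost everywhere. *)
Definition gfun (R : realType) (G : metric_graph R) := edge G -> R -> R[i].

(* A possibly unbounded operator in L^2(G), given by its graph: T f g means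
   that f is in the domain of T and T f = g. *)
Definition operator (R : realType) (G : metric_graph R) :=
  gfun G -> gfun G -> Prop.

Section Operators.
Context {R : realType} {G : metric_graph R}.
Local Notation mu := (@lebesgue_measure R).
Implicit Types (f g h u du ddu w : gfun G) (T : operator G).

Definition L2 f : Prop := forall e, L2_on (len e) (f e).

Definition eqL2 f g : Prop := forall e,
  {ae mu, forall x, `]0, len e[%classic x -> f e x = g e x}.

Definition inner f g : R[i] :=
  \sum_(e : edge G) cintegral `]0, len e[ (fun x => f e x * (g e x)^*).

Definition endpoint (e : edge G) (b : bool) : R := if b then len e else 0.

Definition continuous_at_vertices u : Prop :=
  forall e b e' b', bd e b = bd e' b' ->
    u e (endpoint e b) = u e' (endpoint e' b').

Definition vanishes_at u (v : vertex G) : Prop :=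
  forall e b, bd e b = v -> u e (endpoint e b) = 0.

(* The derivative towards v: du (len e) at the endpoint len e and - du 0 at the
   endpoint 0; both endpoints of a loop at v are counted. *)
Definition normal_derivative du (v : vertex G) : R[i] :=
  \sum_(e : edge G) \sum_(b : bool | bd e b == v)
     (if b then du e (endpoint e b) else - du e (endpoint e b)).

(* f |-> - f'' on those f in H~^2(G) /\ H^1(G) whose representative u and its
   derivative du satisfy the vertex conditions bc u du. *)
Definition laplacian_with (bc : gfun G -> gfun G -> Prop) : operator G :=
  fun f g => [/\ L2 f, L2 g &
    exists u du ddu,
      [/\ forall e, H2_rep (len e) (u e) (du e) (ddu e),
          eqL2 f u,
          eqL2 g (fun e x => - ddu e x),
          continuous_at_vertices u &
          bc u du]].

Definition adjoint T : operator G := fun f g =>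
  [/\ L2 f, L2 g & forall u w, T u w -> inner w f = inner u g].

Definition dom T f : Prop := exists g, T f g.

Definition ker T f : Prop := T f (fun _ _ => 0).

(* The Krein-von Neumann extension of T: the restriction of its adjoint to
   dom T + ker T^*. *)
Definition krein_extension T : operator G := fun f g =>
  adjoint T f g /\
  exists u h, [/\ dom T u, ker (adjoint T) h &
    eqL2 f (fun e x => u e x + h e x)].

Definition linearly_independent n (F : 'I_n -> gfun G) : Prop :=
  forall c : 'I_n -> R[i],
    eqL2 (fun e x => \sum_(i < n) c i * F i e x) (fun _ _ => 0) ->
    forall i, c i = 0.

Definition eigenvector T (m : R) f : Prop := T f (fun e x => m%:C * f e x).

(* dim ker (T - m), possibly +oo; it is 0 if m is not an eigenvalue. *)
Definition multiplicity T (m : R) : \bar R :=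
  ereal_sup [set n%:R%:E | n in [set n : nat |
    exists F : 'I_n -> gfun G,
      (forall i, eigenvector T m (F i)) /\ linearly_independent F]].

(* Number of eigenvalues of T in P that are <= t, with multiplicities. *)
Definition eigenvalue_count T (P : set R) (t : R) : \bar R :=
  \esum_(m in [set m | P m /\ m <= t]) multiplicity T m.

(* The j-th smallest eigenvalue in P (j >= 1), with multiplicities; +oo if there
   are fewer than j of them. Only real eigenvalues are considered, which is no
   restriction for a self-adjoint T. *)
Definition nth_eigenvalue_in T (P : set R) (j : nat) : \bar R :=
  ereal_inf [set t%:E | t in
    [set t : R | (j%:R%:E <= eigenvalue_count T P t)%E]].

Definition nth_eigenvalue T : nat -> \bar R := nth_eigenvalue_in T setT.

Definition nth_positive_eigenvalue T : nat -> \bar R :=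
  nth_eigenvalue_in T [set m | 0 < m].

End Operators.

Definition minimal_laplacian (R : realType) (G : metric_graph R) : operator G :=
  laplacian_with (fun u du =>
    forall v, vanishes_at u v /\ normal_derivative du v = 0).
Arguments minimal_laplacian {R} G _ _.

Definition krein_laplacian (R : realType) (G : metric_graph R) : operator G :=
  krein_extension (minimal_laplacian G).
Arguments krein_laplacian {R} G _ _.

Definition standard_laplacian (R : realType) (G : metric_graph R) : operator G :=
  laplacian_with (fun _ du => forall v, normal_derivative du v = 0).
Arguments standard_laplacian {R} G _ _.

(* Main.v *)
Require Import Defs.
From HB Require Import structures.
From mathcomp Require Import all_boot all_order all_algebra.
From mathcomp Require Import complex.
From mathcomp Require Import all_classical all_reals all_analysis.
From mathcomp Require Import measurable_realfun ring lra zify.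
From mathcomp Require finmap.

Set Implicit Arguments.
Unset Strict Implicit.
Unset Printing Implicit Defensive.
Import Order.TTheory GRing.Theory Num.Theory.
Import numFieldNormedType.Exports.
Local Open Scope classical_set_scope.
Local Open Scope ring_scope.

(** The proof compares both spectra through quadratic forms.

    Let f be an eigenfunction of the Krein Laplacian for m > 0 and write
    f = u + h with u in dom S and h in ker S^*.  Testing the adjoint relation
    against functions supported in one edge shows that f and h have
    representatives of the form: an affine function minus a primitive of a
    primitive of their image under S^* (adjoint_regularity); in particular h is
    affine on each edge and - u'' = m f (krein_eigenvector_data).  Since S u = m f
    is orthogonal to ker S^*, the function f is orthogonal to h and to the
    constants, so that for linear combinations of such f with eigenvalues at
    most t and every constant c
      ||u'||^2 = (- u'', u) <= t ||f||^2 <= t ||u - c||^2.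
    The function u vanishes at all vertices, so its edges can be put end to end
    (glue): u becomes a continuous function on a loop of length L, the total
    length of the graph.  Thus j independent Krein eigenfunctions give a space
    of dimension j + 1 on the loop, spanned by the u and the constants, on
    which the Rayleigh quotient is at most t.

    On the loop the threshold is nu^2 with nu = 2 pi k / L and 2 k - 1 <= j <= 2 k,
    and it is enough to find 2 k - 1 linear conditions on w which force
    ||w'||^2 >= nu^2 ||w||^2.  Instead of the vanishing of Fourier coefficients,
    which would require the completeness of the trigonometric system, the
    conditions are w (x_i) = (-1)^i w (x_0) at 2 k equidistant points.  Then
    v = w - w (0) cos (nu x) vanishes at these points, at distance pi / nu, so
    that the Dirichlet inequality holds for v on each cell; and the form
    ||w'||^2 - nu^2 ||w||^2 takes the same value at v and at w because cos (nu x)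
    is an eigenfunction (wirtinger_alternating).  Hence t >= nu^2
    (rayleigh_loop_bound, krein_bound), and the loop has at least 2 k >= j
    positive eigenvalues up to t, given by sines and cosines.

    The equality between the two eigenvalues of the loop says that 0 is a simple
    eigenvalue and that there is no negative one; both follow from
    ||u'||^2 = m ||u||^2 (loop_energy). *)

(** * Integrals over compact intervals *)

#[global] Instance ae_lebesgue_filter (R : realType) :
  Filter (nbhs (almost_everywhere (@lebesgue_measure R))).
Proof. exact: ae_filter_ringOfSetsType. Qed.

Section IntervalCalculus.
Context {R : realType}.
Local Notation mu := (@lebesgue_measure R).
Implicit Types (a b c d x : R) (f g u v du dv : R -> R).

Definition integrable_on a b f := mu.-integrable `[a, b] (EFin \o f).

Definition rint a b f : R := \int[mu]_(x in `[a, b]) f x.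

Lemma eq_integrable_on a b f g : (forall x, a <= x <= b -> f x = g x) ->
  integrable_on a b f -> integrable_on a b g.
Proof.
move=> fg; apply: eq_integrable => // x /[!inE]/= /[!in_itv]/= xab.
by rewrite fg.
Qed.

Lemma eq_rint a b f g : (forall x, a <= x <= b -> f x = g x) ->
  rint a b f = rint a b g.
Proof.
by move=> fg; apply: eq_Rintegral => x /[!inE]/= /[!in_itv]/= xab; rewrite fg.
Qed.

Lemma integrable_onD a b f g : integrable_on a b f -> integrable_on a b g ->
  integrable_on a b (fun x => f x + g x).
Proof. exact: integrableD. Qed.

Lemma integrable_onZ a b k f : integrable_on a b f ->
  integrable_on a b (fun x => k * f x).
Proof. by move=> /(@integrableZl _ _ _ _ _ _ k); apply. Qed.

Lemma integrable_onB a b f g : integrable_on a b f -> integrable_on a b g ->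
  integrable_on a b (fun x => f x - g x).
Proof. exact: integrableB. Qed.

Lemma integrable_on_sum (I : finType) a b (f : I -> R -> R) :
  (forall i, integrable_on a b (f i)) ->
  integrable_on a b (fun x => \sum_i f i x).
Proof.
move=> fi; have -> : (fun x => \sum_i f i x) = \sum_i f i.
  by apply/funext => x; rewrite fct_sumE.
elim/big_ind : _ => //; last by move=> *; exact: integrable_onD.
exact: integrable0.
Qed.

Lemma integrable_on_measurable a b f : integrable_on a b f ->
  measurable_fun `[a, b] f.
Proof. by move=> /measurable_int/measurable_EFinP. Qed.

Lemma integrable_on_sub a b c d f : a <= c -> d <= b ->
  integrable_on a b f -> integrable_on c d f.
Proof.
move=> ac db; apply: integrableS => // x /=; rewrite !in_itv/=.
by move=> /andP[? ?]; rewrite (le_trans ac)//= (le_trans _ db).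
Qed.

Lemma rintD a b f g : integrable_on a b f -> integrable_on a b g ->
  rint a b (fun x => f x + g x) = rint a b f + rint a b g.
Proof. by move=> fi gi; rewrite /rint RintegralD. Qed.

Lemma rintB a b f g : integrable_on a b f -> integrable_on a b g ->
  rint a b (fun x => f x - g x) = rint a b f - rint a b g.
Proof. by move=> fi gi; rewrite /rint RintegralB. Qed.

Lemma rintZ a b k f : integrable_on a b f ->
  rint a b (fun x => k * f x) = k * rint a b f.
Proof. by move=> fi; rewrite /rint RintegralZl. Qed.

Lemma rintN a b f : integrable_on a b f ->
  rint a b (fun x => - f x) = - rint a b f.
Proof.
move=> fi; rewrite -mulN1r -rintZ//.
by apply: eq_rint => x _; rewrite mulN1r.
Qed.

Lemma rint0 a b : rint a b (fun=> 0) = 0.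
Proof. by rewrite /rint /Rintegral integral0. Qed.

Lemma rint_sum (I : finType) a b (f : I -> R -> R) :
  (forall i, integrable_on a b (f i)) ->
  rint a b (fun x => \sum_i f i x) = \sum_i rint a b (f i).
Proof.
move=> fi; have -> : (fun x => \sum_i f i x) = \sum_i f i.
  by apply/funext => x; rewrite fct_sumE.
suff [//] : integrable_on a b (\sum_i f i) /\
  rint a b (\sum_i f i) = \sum_i rint a b (f i).
elim/big_ind2 : _ => //.
- by split; [exact: integrable0|rewrite -(rint0 a b)].
- move=> x1 x2 y1 y2 [i1 e1] [i2 e2]; split; first exact: integrable_onD.
  by rewrite -e1 -e2 -rintD.
Qed.

Lemma rint_pt a f : rint a a f = 0.
Proof. by rewrite /rint set_itv1 Rintegral_set1. Qed.

Lemma rint_ge0 a b f : (forall x, a <= x <= b -> 0 <= f x) -> 0 <= rint a b f.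
Proof.
by move=> f0; apply: Rintegral_ge0 => x /=; rewrite in_itv/=; exact: f0.
Qed.

Lemma rint_split a b c f : a <= c <= b -> integrable_on a b f ->
  rint a b f = rint a c f + rint c b f.
Proof.
move=> /andP[ac cb] fi; rewrite /rint -(@Rintegral_itv_obnd_cbnd _ c); last first.
  apply: integrableS fi => //= x /=; rewrite !in_itv/= => /andP[cx ->].
  by rewrite andbT (le_trans ac)// ltW.
by rewrite -(@Rintegral_itvB _ _ (BLeft a) (BRight b) c)// ?bnd_simp// addrC subrK.
Qed.

Lemma rint_cst a b k : a <= b -> rint a b (fun=> k) = k * (b - a).
Proof.
move=> ab; rewrite /rint Rintegral_cst//= lebesgue_measure_itv/= lte_fin.
have [//|] := ltP a b.
by rewrite le_eqVlt ltNge ab orbF => /eqP ->; rewrite subrr.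
Qed.

Lemma measurable_fun_sub a b c d f : a <= c -> d <= b ->
  measurable_fun `[a, b] f -> measurable_fun `[c, d] f.
Proof.
move=> ac db; apply: measurable_funS => // x /=; rewrite !in_itv/=.
by move=> /andP[? ?]; rewrite (le_trans ac)//= (le_trans _ db).
Qed.

Lemma integrable_on_bounded a b f : measurable_fun `[a, b] f ->
  [bounded f x | x in `[a, b]] -> integrable_on a b f.
Proof.
move=> mf bf; apply: measurable_bounded_integrable => //.
by rewrite /= lebesgue_measure_itv/=; case: ifP => // _; rewrite ltry.
Qed.

Lemma integrable_on_cst a b k : integrable_on a b (fun=> k).
Proof.
apply: integrable_on_bounded => //.
exists `|k|; split; rewrite ?num_real// => M kM x _ /=; exact: ltW.
Qed.

Lemma integrable_on_le a b f g : measurable_fun `[a, b] f ->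
  (forall x, a <= x <= b -> `|f x| <= g x) ->
  integrable_on a b g -> integrable_on a b f.
Proof.
move=> mf fg; apply: le_integrable => //; first exact/measurable_EFinP.
move=> x /=; rewrite in_itv/= => xab; rewrite lee_fin (le_trans (fg _ xab))//.
exact: ler_norm.
Qed.

Definition sq_integrable_on a b f :=
  measurable_fun `[a, b] f /\ integrable_on a b (fun x => f x ^+ 2).

Lemma sq_integrable_onM a b f g :
  sq_integrable_on a b f -> sq_integrable_on a b g ->
  integrable_on a b (fun x => f x * g x).
Proof.
move=> [mf f2] [mg g2].
apply: (@integrable_on_le _ _ _ (fun x => f x ^+ 2 + g x ^+ 2)).
- exact: measurable_funM.
- move=> x _; rewrite ler_norml; apply/andP; split; last first.
    have := sqr_ge0 (f x - g x); have := sqr_ge0 (f x); have := sqr_ge0 (g x).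
    by nra.
  have := sqr_ge0 (f x + g x); have := sqr_ge0 (f x); have := sqr_ge0 (g x).
  by nra.
- exact: integrable_onD.
Qed.

Lemma sq_integrable_on_cst a b k : sq_integrable_on a b (fun=> k).
Proof. by split => //; exact: integrable_on_cst. Qed.

Lemma sq_integrable_onW a b f : sq_integrable_on a b f -> integrable_on a b f.
Proof.
move=> /sq_integrable_onM/(_ (sq_integrable_on_cst a b 1)).
by apply: eq_integrable_on => x _; rewrite mulr1.
Qed.

Lemma sq_integrable_onD a b f g :
  sq_integrable_on a b f -> sq_integrable_on a b g ->
  sq_integrable_on a b (fun x => f x + g x).
Proof.
move=> f2 g2; split; first by apply: measurable_funD; [case: f2|case: g2].
apply: (@eq_integrable_on _ _ (fun x => f x ^+ 2 + (2 * (f x * g x) + g x ^+ 2))).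
  by move=> x _; ring.
apply: integrable_onD; first by case: f2.
apply: integrable_onD; last by case: g2.
by apply: integrable_onZ; exact: sq_integrable_onM.
Qed.

Lemma sq_integrable_onZ a b k f : sq_integrable_on a b f ->
  sq_integrable_on a b (fun x => k * f x).
Proof.
move=> [mf f2]; split; first exact: measurable_funM.
by under eq_fun do rewrite exprMn; exact: integrable_onZ.
Qed.

Lemma sq_integrable_onN a b f : sq_integrable_on a b f ->
  sq_integrable_on a b (fun x => - f x).
Proof.
move=> /(sq_integrable_onZ (-1)).
by congr (sq_integrable_on _ _ _); apply/funext => x; rewrite mulN1r.
Qed.

Lemma sq_integrable_onB a b f g :
  sq_integrable_on a b f -> sq_integrable_on a b g ->
  sq_integrable_on a b (fun x => f x - g x).
Proof. by move=> f2 /sq_integrable_onN; exact: sq_integrable_onD. Qed.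

Lemma sq_integrable_on_sum (I : finType) a b (f : I -> R -> R) :
  (forall i, sq_integrable_on a b (f i)) ->
  sq_integrable_on a b (fun x => \sum_i f i x).
Proof.
move=> fi; have -> : (fun x => \sum_i f i x) = \sum_i f i.
  by apply/funext => x; rewrite fct_sumE.
elim/big_ind : _ => //; last by move=> *; exact: sq_integrable_onD.
exact: sq_integrable_on_cst.
Qed.

Lemma sq_integrable_on_sub a b c d f : a <= c -> d <= b ->
  sq_integrable_on a b f -> sq_integrable_on c d f.
Proof.
move=> ac db [mf f2]; split; first exact: measurable_fun_sub mf.
exact: integrable_on_sub f2.
Qed.

Definition ae_eq_on a b f g :=
  {ae mu, forall x, a < x < b -> f x = g x}.

(** The definitions of the operators quantify over open intervals, the integrals
    used here are over closed ones. *)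
Lemma ae_open_closed a b (P : R -> Prop) :
  {ae mu, forall x, a < x < b -> P x} ->
  {ae mu, forall x, a <= x <= b -> P x}.
Proof.
have h (c : R) : {ae mu, forall x, x != c}.
  exists [set c]; split => //; first exact: lebesgue_measure_set1.
  by move=> x /=; case: eqVneq => // ->.
apply: filterS3 (h a) (h b) => x /= /negbTE xa /negbTE xb abP.
by rewrite !le_eqVlt eq_sym xa xb; exact: abP.
Qed.

Lemma rint_ae_eq a b f g : measurable_fun `[a, b] f -> measurable_fun `[a, b] g ->
  ae_eq_on a b f g -> rint a b f = rint a b g.
Proof.
move=> mf mg /ae_open_closed fg; congr fine; apply: ae_eq_integral => //.
- exact/measurable_EFinP.
- exact/measurable_EFinP.
by apply: filterS fg => x /= fg /[!in_itv]/= /fg ->.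
Qed.

Lemma rint_sqr_eq0 a b f : sq_integrable_on a b f ->
  rint a b (fun x => f x ^+ 2) <= 0 -> ae_eq_on a b f (fun=> 0).
Proof.
move=> [mf f2] f20.
have : (\int[mu]_(x in `[a, b]) `|(f x ^+ 2)%R%:E| = 0)%E.
  under eq_integral do rewrite /= ger0_norm ?sqr_ge0//.
  rewrite -[LHS]fineK; last exact: integrable_fin_num.
  congr EFin; apply/eqP; rewrite eq_le f20/=.
  by rewrite fine_ge0// integral_ge0// => x _; rewrite lee_fin sqr_ge0.
move/ae_eq_integral_abs => /(_ _ _)/=; rewrite /ae_eq => h.
have := h (ltac:(done)) (ltac:(by have /integrableP[] := f2)).
apply: filterS => x /= + /andP[ax xb]; rewrite in_itv/= !ltW// => /(_ isT)[].
by move/eqP; rewrite sqrf_eq0 => /eqP.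
Qed.

End IntervalCalculus.

(** * Absolutely continuous functions *)

Section AbsolutelyContinuous.
Context {R : realType}.
Local Notation mu := (@lebesgue_measure R).
Implicit Types (a b c d x : R) (f g u v du dv : R -> R).

(** The density du is part of the data and is only determined up to a null
    set, like the derivative in the weak sense. *)
Definition abs_cont a b u du :=
  integrable_on a b du /\ forall x, a <= x <= b -> u x = u a + rint a x du.

Lemma abs_cont_cst a b k : abs_cont a b (fun=> k) (fun=> 0).
Proof.
split; first exact: integrable_on_cst.
by move=> x _; rewrite rint0 addr0.
Qed.

Lemma abs_contD a b u v du dv : abs_cont a b u du -> abs_cont a b v dv ->
  abs_cont a b (fun x => u x + v x) (fun x => du x + dv x).
Proof.
move=> [iu eu] [iv ev]; split; first exact: integrable_onD.
move=> x xab; have /andP[ax xb] := xab; rewrite eu// ev// rintD; first ring.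
  exact: integrable_on_sub iu.
exact: integrable_on_sub iv.
Qed.

Lemma abs_contZ a b k u du : abs_cont a b u du ->
  abs_cont a b (fun x => k * u x) (fun x => k * du x).
Proof.
move=> [iu eu]; split; first exact: integrable_onZ.
move=> x xab; have /andP[ax xb] := xab; rewrite eu// rintZ; first ring.
exact: integrable_on_sub iu.
Qed.

Lemma abs_contB a b u v du dv : abs_cont a b u du -> abs_cont a b v dv ->
  abs_cont a b (fun x => u x - v x) (fun x => du x - dv x).
Proof.
move=> hu /(abs_contZ (-1)) /(abs_contD hu).
by congr (abs_cont _ _ _ _); apply/funext => x; rewrite mulN1r.
Qed.

Lemma abs_cont_sum (I : finType) a b (u du : I -> R -> R) :
  (forall i, abs_cont a b (u i) (du i)) ->
  abs_cont a b (fun x => \sum_i u i x) (fun x => \sum_i du i x).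
Proof.
move=> h; split; first by apply: integrable_on_sum => i; case: (h i).
move=> x xab; have /andP[ax xb] := xab.
rewrite rint_sum; last by move=> i; have [/integrable_on_sub + _] := h i; exact.
by rewrite -big_split/=; apply: eq_bigr => i _; case: (h i) => _; exact.
Qed.

Lemma eq_abs_cont a b u v du dv : a <= b ->
  (forall x, a <= x <= b -> u x = v x) ->
  (forall x, a <= x <= b -> du x = dv x) ->
  abs_cont a b u du -> abs_cont a b v dv.
Proof.
move=> ab uv duv [iu eu]; split; first exact: eq_integrable_on iu.
move=> x xab; have /andP[ax xb] := xab; rewrite -!uv ?lexx ?ab// eu//.
congr (_ + _); apply: eq_rint => y /andP[ay yx]; apply: duv.
by rewrite ay (le_trans yx).
Qed.

Lemma abs_cont_sub a b c d u du : a <= c -> c <= d -> d <= b ->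
  abs_cont a b u du -> abs_cont c d u du.
Proof.
move=> ac cd db [iu eu]; split; first exact: integrable_on_sub iu.
move=> x /andP[cx xd]; have xb := le_trans xd db.
rewrite eu ?(le_trans ac)// (eu c) ?ac ?(le_trans cd)// -addrA -rint_split ?ac//.
exact: integrable_on_sub iu.
Qed.

Lemma abs_cont_continuous a b u du : a <= b -> abs_cont a b u du ->
  {within `[a, b], continuous u}.
Proof.
move=> ab [iu eu].
have : {within `[a, b], continuous (fun x => u a + rint a x du)}.
  by move=> x; apply: cvgD; [exact: cvg_cst|exact: parameterized_integral_continuous].
apply: subspace_eq_continuous => x /[!inE]/=; rewrite in_itv/= => xab.
by rewrite /from_subspace (eu x xab).
Qed.

Lemma abs_cont_measurable a b u du : a <= b -> abs_cont a b u du ->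
  measurable_fun `[a, b] u.
Proof.
by move=> ab /(abs_cont_continuous ab); exact: subspace_continuous_measurable_fun.
Qed.

Lemma abs_cont_bounded a b u du : a <= b -> abs_cont a b u du ->
  [bounded u x | x in `[a, b]].
Proof.
move=> ab /(abs_cont_continuous ab) cu.
have /compact_bounded := continuous_compact cu (@segment_compact _ a b).
move=> [M [rM uM]]; exists M; split => // y My x /= xab.
by apply: (uM y) => //=; exists x.
Qed.

Lemma abs_cont_integrableM a b u du f : a <= b -> abs_cont a b u du ->
  integrable_on a b f -> integrable_on a b (fun x => u x * f x).
Proof.
move=> ab hu; apply: integrableMr => //.
- exact: abs_cont_measurable hu.
- exact: abs_cont_bounded hu.
Qed.

Lemma abs_cont_sq_integrableM a b u du f : a <= b -> abs_cont a b u du ->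
  sq_integrable_on a b f -> sq_integrable_on a b (fun x => u x * f x).
Proof.
move=> ab hu [mf f2]; split.
  by apply: measurable_funM => //; exact: abs_cont_measurable hu.
have := abs_cont_integrableM ab hu (abs_cont_integrableM ab hu f2).
by apply: eq_integrable_on => x _; ring.
Qed.

Lemma abs_cont_sq_integrable a b u du : a <= b -> abs_cont a b u du ->
  sq_integrable_on a b u.
Proof.
move=> ab hu.
have := abs_cont_sq_integrableM ab hu (sq_integrable_on_cst a b 1).
by congr (sq_integrable_on _ _ _); apply/funext => x; rewrite mulr1.
Qed.

Lemma abs_cont_integrable a b u du : a <= b -> abs_cont a b u du ->
  integrable_on a b u.
Proof. by move=> ab hu; exact/sq_integrable_onW/(abs_cont_sq_integrable ab hu). Qed.

Lemma abs_cont_primitive a b f : a <= b -> integrable_on a b f ->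
  abs_cont a b (fun x => rint a x f) f.
Proof. by move=> ab fi; split => // x _; rewrite rint_pt add0r. Qed.

Lemma Rintegral_restrict a b f :
  \int[mu]_x (f \_ `[a, b]) x = rint a b f.
Proof. by rewrite [RHS]Rintegral_mkcond. Qed.

(** Both sides are the integral of f x * g y over the triangle a <= y <= x <= b;
    this is the source of integration by parts for absolutely continuous
    functions. *)
Lemma rint_triangle a b f g : a <= b -> integrable_on a b f -> integrable_on a b g ->
  rint a b (fun x => f x * rint a x g) = rint a b (fun y => g y * rint y b f).
Proof.
move=> ab fi gi.
pose F : R -> R := f \_ `[a, b]; pose G : R -> R := g \_ `[a, b].
have restrict_integrable h : integrable_on a b h ->
    mu.-integrable setT (EFin \o (h \_ `[a, b])).
  by move=> hi; rewrite -restrict_EFin; apply/integrable_restrict => //; rewrite setTI.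
have Fi := restrict_integrable f fi; have Gi := restrict_integrable g gi.
have mF : measurable_fun setT F by apply/measurable_EFinP; exact: measurable_int Fi.
have mG : measurable_fun setT G by apply/measurable_EFinP; exact: measurable_int Gi.
pose T (z : R * R) : R := \1_[set z : R * R | z.2 <= z.1] z.
have mT : measurable_fun [set: R * R] T.
  apply: measurable_indic.
  have /(_ measurableT [set true]) := @measurable_fun_ler _ _ _ [set: R * R]
    (fun z => z.2) (fun z => z.1) (@measurable_snd _ _ _ _) (@measurable_fst _ _ _ _).
  by rewrite setTI; apply.
have TE x y : T (x, y) = (y <= x)%R%:R by rewrite /T indicE mem_setE.
(* f x * g y on the triangle, 0 elsewhere in the plane. *)
pose k (z : R * R) : R := F z.1 * G z.2 * T z.
have mk : measurable_fun [set: R * R] k.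
  apply: measurable_funM => //; apply: measurable_funM.
    exact: measurableT_comp mF (@measurable_fst _ _ _ _).
  exact: measurableT_comp mG (@measurable_snd _ _ _ _).
have T1 z : `|T z| <= 1.
  by rewrite /T indicE; case: (_ \in _); rewrite ?normr1 ?normr0.
have EFin_int h : mu.-integrable setT (EFin \o h) ->
    (\int[mu]_x (h x)%:E = (\int[mu]_x h x)%:E)%E.
  by move=> hi; rewrite /Rintegral fineK//; exact: integrable_fin_num hi.
have ki : (mu \x mu)%E.-integrable setT (EFin \o k).
  apply/integrable12ltyP; first exact/measurable_EFinP.
  apply: (@le_lt_trans _ _ (\int[mu]_x (`|F x| * \int[mu]_y `|G y|)%:E)%E).
    apply: ge0_le_integral => //.
    - by move=> x _; apply: integral_ge0.
    - apply: (measurable_fun_fubini_tonelli_F (m2 := mu) (abse \o (EFin \o k))) => //.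
        exact/measurableT_comp/measurable_EFinP.
      by move=> z; exact: abse_ge0.
    - by apply/measurable_EFinP/measurable_funM => //; exact: measurableT_comp.
    move=> x _; rewrite EFinM -EFin_int; last exact: integrable_norm Gi.
    rewrite -ge0_integralZl//; last exact/measurable_EFinP/measurableT_comp.
    apply: ge0_le_integral => //.
    - apply: measurableT_comp => //; apply/measurable_EFinP.
      exact: (measurableT_comp mk (@measurable_pair1 _ _ _ _ x)).
    - by apply/measurable_EFinP/measurable_funM => //; exact: measurableT_comp.
    by move=> y _; rewrite lee_fin !normrM ler_piMr.
  rewrite (EFin_int (fun x => `|F x| * _)) ?ltry//.
  exact: (integrableZr measurableT _ (integrable_norm Fi)).
have kx x : (\int[mu]_y (EFin \o k) (x, y) =
    (((fun x => f x * rint a x g) \_ `[a, b]) x)%:E)%E.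
  rewrite patchE /k /=; case: ifPn => xab; last first.
    rewrite (eq_integral (fun=> 0%E)) ?integral0// => y _.
    by rewrite /F patchE (negbTE xab) !mul0r.
  have /andP[ax xb] : a <= x <= b by move: xab; rewrite inE/= in_itv.
  have gx : integrable_on a x g by exact: integrable_on_sub gi.
  have -> : (fun y => (F x * G y * T (x, y))%:E) =
            (fun y => (f x * (g \_ `[a, x]) y)%:E).
    apply/funext => y; rewrite TE /F /G !patchE xab -mulrA; congr (_ * _)%:E.
    rewrite !mem_setE !in_itv/=.
    case: (leP a y) => ay /=; last by rewrite mul0r.
    by case: (leP y x) => yx; rewrite ?mulr0// mulr1 (le_trans yx xb).
  have gxi : mu.-integrable setT (EFin \o (g \_ `[a, x])).
    by rewrite -restrict_EFin; apply/integrable_restrict => //; rewrite setTI.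
  rewrite EFin_int; last exact: (integrableZl measurableT _ gxi).
  by rewrite RintegralZl// Rintegral_restrict.
have ky y : (\int[mu]_x (EFin \o k) (x, y) =
    (((fun y => g y * rint y b f) \_ `[a, b]) y)%:E)%E.
  rewrite patchE /k /=; case: ifPn => yab; last first.
    rewrite (eq_integral (fun=> 0%E)) ?integral0// => x _.
    by rewrite /G patchE (negbTE yab) mulr0 !mul0r.
  have /andP[ay yb] : a <= y <= b by move: yab; rewrite inE/= in_itv.
  have fy : integrable_on y b f by exact: integrable_on_sub fi.
  have -> : (fun x => (F x * G y * T (x, y))%:E) =
            (fun x => (g y * (f \_ `[y, b]) x)%:E).
    apply/funext => x; rewrite TE /F /G !patchE yab mulrAC mulrC; congr (_ * _)%:E.
    rewrite !mem_setE !in_itv/=.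
    case: (leP y x) => yx /=; last by rewrite mulr0.
    by rewrite (le_trans ay yx) mulr1.
  have fyi : mu.-integrable setT (EFin \o (f \_ `[y, b])).
    by rewrite -restrict_EFin; apply/integrable_restrict => //; rewrite setTI.
  rewrite EFin_int; last exact: (integrableZl measurableT _ fyi).
  by rewrite RintegralZl// Rintegral_restrict.
have := Fubini ki.
under eq_integral do rewrite kx.
under [in X in _ = X -> _]eq_integral do rewrite ky.
by move=> /(congr1 fine); rewrite -!Rintegral_restrict.
Qed.

(** With u and v replaced by their integral formulas, the two double integrals
    over triangles add up to the product of the total increments. *)
Lemma abs_cont_by_parts a b u v du dv : a <= b ->
  abs_cont a b u du -> abs_cont a b v dv ->
  rint a b (fun x => u x * dv x + v x * du x) = u b * v b - u a * v a.
Proof.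
move=> ab hu hv; have [iu eu] := hu; have [iv ev] := hv.
rewrite rintD; [|exact: abs_cont_integrableM hu iv|exact: abs_cont_integrableM hv iu].
have -> : rint a b (fun x => v x * du x) =
    v a * rint a b du + rint a b (fun x => du x * rint a x dv).
  rewrite -rintZ// -rintD; last 2 first.
  - exact: integrable_onZ.
  - have [_] := abs_cont_primitive ab iv.
    have := abs_cont_integrableM ab (abs_cont_primitive ab iv) iu.
    by move=> h _; apply: eq_integrable_on h => x _; rewrite mulrC.
  by apply: eq_rint => x xab; rewrite ev//; ring.
rewrite rint_triangle//.
have -> : rint a b (fun x => u x * dv x) =
    u b * rint a b dv - rint a b (fun y => dv y * rint y b du).
  rewrite -rintZ// -rintB; first last.
  - have h : integrable_on a b (fun y => u b * dv y - u y * dv y).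
      apply: integrable_onB; first exact: integrable_onZ.
      exact: abs_cont_integrableM hu iv.
    apply: eq_integrable_on h => x /andP[ax xb].
    rewrite eu ?lexx ?ab// (rint_split (c := x)) ?ax// [u x]eu ?ax//; ring.
  - exact: integrable_onZ.
  apply: eq_rint => x /andP[ax xb].
  rewrite [u b]eu ?lexx ?ab// (rint_split (c := x)) ?ax// [u x]eu ?ax//; ring.
by rewrite [u b]eu ?[v b]ev ?lexx ?ab//; ring.
Qed.

Lemma abs_contM a b u v du dv : a <= b ->
  abs_cont a b u du -> abs_cont a b v dv ->
  abs_cont a b (fun x => u x * v x) (fun x => u x * dv x + v x * du x).
Proof.
move=> ab hu hv; split.
  have [iu _] := hu; have [iv _] := hv.
  by apply: integrable_onD; [exact: abs_cont_integrableM hu iv|exact: abs_cont_integrableM hv iu].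
move=> x /andP[ax xb]; rewrite abs_cont_by_parts//; first by ring.
  exact: abs_cont_sub hu.
exact: abs_cont_sub hv.
Qed.

End AbsolutelyContinuous.

(** * Trigonometric functions and the Dirichlet inequality *)

Section Trigonometric.
Context {R : realType}.
Implicit Types (a b c d x : R) (f g u v du dv : R -> R).

Lemma abs_cont_derive a b u du : a <= b ->
  (forall x, a <= x <= b -> is_derive x 1 u (du x) /\ {for x, continuous du}) ->
  abs_cont a b u du.
Proof.
move=> ab udu; have cdu : {within `[a, b], continuous du}.
  apply: continuous_in_subspaceT => x /[!inE]/=; rewrite in_itv/= => /udu.
  by case.
split; first by apply: continuous_compact_integrable => //; exact: segment_compact.
move=> x /andP[+ xb]; rewrite le_eqVlt => /predU1P[<-|ax].
  by rewrite rint_pt addr0.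
have cu y : a <= y <= b -> {for y, continuous u}.
  by move=> /udu[[ud _] _]; exact/differentiable_continuous/derivable1_diffP.
have := @continuous_FTC2 _ du u a x ax _ _ _.
rewrite /rint /Rintegral => ->; first by rewrite -EFinB/= addrC subrK.
- apply: continuous_subspaceW cdu => y /=; rewrite !in_itv/= => /andP[-> yx].
  exact: le_trans xb.
- split.
  + move=> y /[!in_itv]/= /andP[ay yx].
    by have [|[]] := udu y _; rewrite ?(ltW ay)//= (le_trans (ltW yx)).
  + apply/cvg_at_right_filter/cu; by rewrite lexx.
  + by apply/cvg_at_left_filter/cu; rewrite (ltW ax).
- move=> y /[!in_itv]/= /andP[ay yx]; rewrite derive1E.
  by have [|[]] := udu y _; rewrite ?(ltW ay)//= (le_trans (ltW yx)).
Qed.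

Lemma is_derive_affine (k m x : R) : is_derive x 1 (fun y => k * (y - m)) k.
Proof.
have -> : (fun y => k * (y - m)) = k \*: (@idfun R - cst m) by [].
by apply: is_derive_eq; rewrite subr0 /GRing.scale/= mulr1.
Qed.

Lemma continuous_affine (k m : R) : continuous (fun y => k * (y - m)).
Proof.
move=> x; have [d _] := is_derive_affine k m x.
exact/differentiable_continuous/derivable1_diffP.
Qed.

Lemma abs_cont_comp_affine a b k m u du : a <= b ->
  (forall x, a <= x <= b -> is_derive (k * (x - m)) 1 u (du (k * (x - m))) /\
     {for k * (x - m), continuous du}) ->
  abs_cont a b (fun x => u (k * (x - m))) (fun x => k * du (k * (x - m))).
Proof.
move=> ab h; apply: abs_cont_derive => // x /h[hu cu]; split.
  have := @is_derive1_comp _ u (fun y => k * (y - m)) x _ _ hu (is_derive_affine k m x).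
  by rewrite mulrC.
have cdu : {for x, continuous (fun y => du (k * (y - m)))}.
  by apply: (@continuous_comp _ _ _ (fun y => k * (y - m))) => //; exact: continuous_affine.
by apply: cvgM; [exact: cvg_cst|exact: cdu].
Qed.

Lemma abs_cont_affine a b k m : a <= b ->
  abs_cont a b (fun x => k * (x - m)) (fun=> k).
Proof.
move=> ab; apply: abs_cont_derive => // x _; split; first exact: is_derive_affine.
exact: cvg_cst.
Qed.

Lemma abs_cont_id a b : a <= b -> abs_cont a b (fun x => x) (fun=> 1).
Proof.
move=> ab; apply: eq_abs_cont (abs_cont_affine 1 0 ab) => // x _.
by rewrite subr0 mul1r.
Qed.

Lemma abs_cont_cos a b k : a <= b ->
  abs_cont a b (fun x => cos (k * x)) (fun x => - k * sin (k * x)).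
Proof.
move=> ab; have := @abs_cont_comp_affine a b k 0 cos (fun x => - sin x) ab.
move/(_ _)/wrap; case.
  move=> x _; split; first exact: is_derive_cos.
  by apply: cvgN; exact: continuous_sin.
by apply: eq_abs_cont => // x _; rewrite subr0 // mulrN mulNr.
Qed.

Lemma abs_cont_sin a b k : a <= b ->
  abs_cont a b (fun x => sin (k * x)) (fun x => k * cos (k * x)).
Proof.
move=> ab; have := @abs_cont_comp_affine a b k 0 sin cos ab.
move/(_ _)/wrap; case.
  by move=> x _; split; [exact: is_derive_sin|exact: continuous_cos].
by apply: eq_abs_cont => // x _; rewrite subr0.
Qed.

(** Jacobi's argument: with tau = tan (nu (x - m)) one has tau' = nu (1 + tau^2),
    hence v'^2 - nu^2 v^2 + (nu tau v^2)' = (v' + nu tau v)^2 >= 0, and the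
    derivative integrates to 0.  The strict bound on nu (b - a) keeps tau bounded
    on [a, b]. *)
Lemma dirichlet_interval_lt a b nu v dv : a < b ->
  abs_cont a b v dv -> sq_integrable_on a b dv -> v a = 0 -> v b = 0 ->
  0 < nu -> nu * (b - a) < pi ->
  nu ^+ 2 * rint a b (fun x => v x ^+ 2) <= rint a b (fun x => dv x ^+ 2).
Proof.
move=> ltab hv dv2 va vb nu0 nuba; have ab := ltW ltab.
pose m := (a + b) / 2; pose t x : R := tan (nu * (x - m)).
have ht : abs_cont a b t (fun x => nu * (1 + t x ^+ 2)).
  apply: (@abs_cont_comp_affine a b nu m tan (fun y => 1 + tan y ^+ 2)) => // x /andP[ax xb].
  have c0 : cos (nu * (x - m)) != 0.
    by apply/lt0r_neq0/cos_gt0_pihalf; apply/andP; split; rewrite /m; nra.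
  split.
    by rewrite -cos2_tan2//; exact: is_derive_tan.
  apply: cvgD; first exact: cvg_cst.
  have ct := continuous_tan c0.
  have -> : (fun x => tan x ^+ 2 : R) = (fun x => tan x * tan x).
    by apply/funext => y; rewrite expr2.
  by apply: cvgM.
have hvv := abs_contM ab hv hv.
have htvv := abs_contZ nu (abs_contM ab ht hvv).
pose e x := nu * (t x * (v x * dv x + v x * dv x) + v x * v x * (nu * (1 + t x ^+ 2))).
have ei : integrable_on a b e by case: htvv.
have e0 : rint a b e = 0.
  have [_ /(_ b)] := htvv; rewrite lexx ab => /(_ isT); rewrite va vb !mulr0 add0r.
  by move=> <-.
have dv2i := dv2.2; have v2i := (abs_cont_sq_integrable ab hv).2.
rewrite -subr_ge0 -rintZ// -rintB//; last exact: integrable_onZ.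
rewrite -[leRHS]addr0 -[X in _ <= _ + X]e0 -rintD//; last first.
  by apply: integrable_onB => //; exact: integrable_onZ.
apply: rint_ge0 => x _; rewrite /e.
have -> : dv x ^+ 2 - nu ^+ 2 * v x ^+ 2 +
  nu * (t x * (v x * dv x + v x * dv x) + v x * v x * (nu * (1 + t x ^+ 2))) =
  (dv x + nu * t x * v x) ^+ 2 by ring.
exact: sqr_ge0.
Qed.

(** The critical length pi / nu is the limit of the subcritical case applied to
    t nu for t < 1. *)
Lemma dirichlet_interval a b nu v dv : a < b ->
  abs_cont a b v dv -> sq_integrable_on a b dv -> v a = 0 -> v b = 0 ->
  0 < nu -> nu * (b - a) <= pi ->
  nu ^+ 2 * rint a b (fun x => v x ^+ 2) <= rint a b (fun x => dv x ^+ 2).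
Proof.
move=> ab hv dv2 va vb nu0 nuba.
have V0 : 0 <= rint a b (fun x => v x ^+ 2) by apply: rint_ge0 => x _; exact: sqr_ge0.
have D0 : 0 <= rint a b (fun x => dv x ^+ 2) by apply: rint_ge0 => x _; exact: sqr_ge0.
set V := rint a b _ in V0 *; set D := rint a b _ in D0 *.
have h t : 0 < t < 1 -> t ^+ 2 * (nu ^+ 2 * V) <= D.
  move=> /andP[t0 t1]; rewrite mulrA -exprMn; apply: dirichlet_interval_lt => //.
    exact: mulr_gt0.
  by rewrite -mulrA (lt_le_trans _ nuba)// gtr_pMl// mulr_gt0// subr_gt0.
rewrite leNgt; apply/negP => DV.
set N := nu ^+ 2 * V in h DV; have N0 : 0 < N by exact: le_lt_trans DV.
(* For q = D / N < 1 the midpoint t of q and 1 satisfies t ^ 2 > q. *)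
pose t := (1 + D / N) / 2.
have DN1 : D / N < 1 by rewrite ltr_pdivrMr// mul1r.
have DN0 : 0 <= D / N by rewrite divr_ge0// ltW.
have := h t; rewrite -ler_pdivlMr//.
have -> : 0 < t < 1 by rewrite /t; apply/andP; split; lra.
move=> /(_ isT); apply/negP; rewrite -ltNge.
have -> : D / N = 2 * t - 1 by rewrite /t [2 * _]mulrC divfK// addrC addKr.
have t1 : 0 < 1 - t by rewrite subr_gt0 /t; lra.
have -> : t ^+ 2 = 2 * t - 1 + (1 - t) ^+ 2 by ring.
by rewrite ltrDl exprn_gt0.
Qed.

End Trigonometric.

(** * A Wirtinger inequality on the loop *)

Section Loop.
Context {R : realType}.
Local Notation mu := (@lebesgue_measure R).
Implicit Types (a b c d x : R) (f g u v w du dv dw : R -> R).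

Lemma cos_npi k : cos (k%:R * pi) = (-1) ^+ k :> R.
Proof.
have := alternatingn (@cosDpi R) k 0.
by rewrite add0r cos0 mulr1 -[pi *+ k]mulr_natl.
Qed.

Lemma sin_npi k : sin (k%:R * pi) = 0 :> R.
Proof.
have := alternatingn (@sinDpi R) k 0.
by rewrite add0r sin0 mulr0 -[pi *+ k]mulr_natl.
Qed.

(** The function v = w - w 0 * cos (nu x) vanishes at all the points k L / N, which
    are at distance pi / nu, so the Dirichlet inequality holds on each cell.  The
    conditions on w cut out a space of codimension N - 1, the number of
    eigenvalues of the loop below nu ^ 2. *)
Lemma wirtinger_alternating L m w dw (N := m.*2) (nu := pi * N%:R / L) :
  0 < L -> (0 < m)%N -> abs_cont 0 L w dw -> sq_integrable_on 0 L dw ->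
  w L = w 0 ->
  (forall k, (k < N)%N -> w (k%:R * (L / N%:R)) = (-1) ^+ k * w 0) ->
  nu ^+ 2 * rint 0 L (fun x => w x ^+ 2) <= rint 0 L (fun x => dw x ^+ 2).
Proof.
move=> L0 m0 hw dw2 wL wk; have L0' := ltW L0.
have N0 : 0 < N%:R :> R by rewrite ltr0n /N double_gt0.
have nu0 : 0 < nu by rewrite /nu divr_gt0// mulr_gt0// pi_gt0.
pose A := w 0; pose xk (k : nat) : R := k%:R * (L / N%:R).
have nuxk k : nu * xk k = k%:R * pi.
  by rewrite /nu /xk; field; rewrite !lt0r_neq0.
have xkN : xk N = L by rewrite /xk mulrC divfK// lt0r_neq0.
have wxk k : (k <= N)%N -> w (xk k) = A * cos (nu * xk k).
  rewrite leq_eqVlt nuxk cos_npi => /predU1P[->|kN]; last by rewrite wk// mulrC.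
  by rewrite xkN wL /A /N -mul2n exprM sqrrN expr1n expr1n mulr1.
pose v x := w x - A * cos (nu * x).
pose dv x := dw x - A * (- nu * sin (nu * x)).
have hc := @abs_cont_cos R 0 L nu L0'.
have hs := @abs_cont_sin R 0 L nu L0'.
have hv : abs_cont 0 L v dv by exact: abs_contB hw (abs_contZ A hc).
have s2 : sq_integrable_on 0 L (fun x => sin (nu * x)) by exact: abs_cont_sq_integrable hs.
have c2 : sq_integrable_on 0 L (fun x => cos (nu * x)) by exact: abs_cont_sq_integrable hc.
have v2 := abs_cont_sq_integrable L0' hv.
have dv2 : sq_integrable_on 0 L dv.
  by apply: sq_integrable_onB => //; do 2 apply: sq_integrable_onZ.
have vxk k : (k <= N)%N -> v (xk k) = 0 by move=> kN; rewrite /v wxk// subrr.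
have xkS k : xk k.+1 = xk k + L / N%:R by rewrite /xk -natr1 mulrDl mul1r.
have h0 : 0 < L / N%:R by rewrite divr_gt0.
have xk0 k : 0 <= xk k by rewrite /xk mulr_ge0// ltW.
have cells k : (k <= N)%N -> nu ^+ 2 * rint 0 (xk k) (fun x => v x ^+ 2) <=
    rint 0 (xk k) (fun x => dv x ^+ 2).
  elim: k => [|k IH kN]; first by rewrite /xk mul0r !rint_pt mulr0.
  have xle : xk k.+1 <= L.
    by rewrite -xkN /xk ler_pM2r// ler_nat.
  have xlt : xk k < xk k.+1 by rewrite xkS ltrDl.
  have v2i : integrable_on 0 (xk k.+1) (fun x => v x ^+ 2) by exact: integrable_on_sub v2.2.
  have dv2i : integrable_on 0 (xk k.+1) (fun x => dv x ^+ 2) by exact: integrable_on_sub dv2.2.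
  have xkk : 0 <= xk k <= xk k.+1 by rewrite xk0 ltW.
  rewrite (rint_split xkk v2i) (rint_split xkk dv2i).
  rewrite mulrDr lerD ?IH//; first exact: ltnW.
  apply: dirichlet_interval => //.
  - by apply: abs_cont_sub hv => //; exact: ltW.
  - exact: sq_integrable_on_sub dv2.
  - by rewrite vxk// ltnW.
  - by rewrite vxk.
  - by rewrite mulrBr !nuxk -mulrBl -natr1 addrAC subrr add0r mul1r.
have := cells N (leqnn _); rewrite xkN -subr_ge0.
rewrite -(subr_ge0 (nu ^+ 2 * _)).
(* The form takes the same value at w and at v: the mixed term and the form at
   cos (nu x) are, up to factors, the integrals of the derivatives of
   sin (nu x) * v and of sin (nu x) * cos (nu x), which vanish at 0 and L. *)
suff -> : rint 0 L (fun x => dw x ^+ 2) - nu ^+ 2 * rint 0 L (fun x => w x ^+ 2) =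
  rint 0 L (fun x => dv x ^+ 2) - nu ^+ 2 * rint 0 L (fun x => v x ^+ 2) by [].
have sv := abs_cont_by_parts L0' hs hv.
have sc := abs_cont_by_parts L0' hs hc.
have sL : sin (nu * L) = 0 by rewrite -xkN nuxk sin_npi.
rewrite sL !mulr0 sin0 !mul0r subrr in sv sc.
have w2 := abs_cont_sq_integrable L0' hw.
have i1 := (abs_contM L0' hs hv).1; have i2 := (abs_contM L0' hs hc).1.
rewrite -!rintZ//; [|exact: v2.2|exact: w2.2].
rewrite -!rintB//; [|exact: dv2.2|by apply: integrable_onZ; exact: v2.2
  |exact: dw2.2|by apply: integrable_onZ; exact: w2.2].
set F := rint 0 L _; set G := rint 0 L _.
have iG := integrable_onB dv2.2 (integrable_onZ (nu ^+ 2) v2.2).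
have i1' := integrable_onZ (2 * A * nu) i1; have i2' := integrable_onZ (A ^+ 2 * nu) i2.
have -> : F = G - 2 * A * nu * 0 - A ^+ 2 * nu * 0.
  rewrite -[X in _ - _ * X - _]sv -[X in _ - _ - _ * X]sc -(rintZ _ i1) -(rintZ _ i2).
  rewrite /G -(rintB iG i1') -(rintB (integrable_onB iG i1') i2').
  apply: eq_rint => x _; rewrite /dv /v.
  ring.
by rewrite !mulr0 !subr0.
Qed.

End Loop.

(** * Putting the edges end to end *)

Section Gluing.
Context {R : realType}.
Local Notation mu := (@lebesgue_measure R).
Implicit Types (a b c d x l : R) (f g u v w du dv dw : R -> R).

Lemma integrable_on_oo a b f :
  integrable_on a b f <-> mu.-integrable `]a, b[ (EFin \o f).
Proof.
split; first by apply: integrableS => //; exact: subset_itv_oo_cc.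
move=> /integrableP[mf fi]; apply/integrableP; split.
  exact: emeasurable_fun_itv_cc mf.
rewrite (integral_itv_bndoo true false)//.
by apply/measurable_EFinP/measurableT_comp => //; exact/measurable_EFinP.
Qed.

Lemma rint_oo a b f : measurable_fun `]a, b[ f ->
  rint a b f = \int[mu]_(x in `]a, b[) f x.
Proof. by move=> mf; rewrite /rint /Rintegral integral_itv_bndoo//; exact/measurable_EFinP. Qed.

Lemma eq_integrable_on_oo a b f g : (forall x, a < x < b -> f x = g x) ->
  integrable_on a b f -> integrable_on a b g.
Proof.
move=> fg /integrable_on_oo fi; apply/integrable_on_oo; apply: eq_integrable fi => //.
by move=> x /[!inE]/= /[!in_itv]/= xab; rewrite fg.
Qed.

Lemma eq_rint_oo a b f g : (forall x, a < x < b -> f x = g x) ->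
  integrable_on a b f -> rint a b f = rint a b g.
Proof.
move=> fg fi; have gi := eq_integrable_on_oo fg fi.
apply: rint_ae_eq; [exact: integrable_on_measurable|exact: integrable_on_measurable|].
exact: aeW.
Qed.

Lemma integrable_on_union a b c f : a <= c <= b ->
  integrable_on a c f -> integrable_on c b f -> integrable_on a b f.
Proof.
move=> /andP[ac cb] fac fcb.
have restrict_int (D : set R) : measurable D -> mu.-integrable D (EFin \o f) <->
    mu.-integrable setT (EFin \o (f \_ D)).
  by move=> mD; rewrite -restrict_EFin -integrable_restrict// setTI.
have {}fcb : mu.-integrable `]c, b] (EFin \o f).
  by apply: integrableS fcb => //; apply: subset_itvr; rewrite bnd_simp.
apply/restrict_int => //.
have -> : (EFin \o (f \_ `[a, b])) = (EFin \o (f \_ `[a, c])) \+ (EFin \o (f \_ `]c, b])).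
  apply/funext => x /=; rewrite -EFinD; congr EFin; rewrite !patchE !mem_setE !in_itv/=.
  case: (leP a x) => ax /=; case: (leP x c) => xc /=; rewrite ?addr0 ?add0r//.
  - by rewrite (le_trans xc).
  - by move: (le_lt_trans ac xc); rewrite ltNge ltW.
by apply: integrableD => //; apply/restrict_int.
Qed.

(** A measure is determined by its values on bounded intervals. *)
Lemma pushforward_shift c (A : set R) : measurable A ->
  mu A = pushforward mu (fun x : measurableTypeR R => x - c : measurableTypeR R) A.
Proof.
have mphi : measurable_fun setT (fun x : measurableTypeR R => x - c : measurableTypeR R).
  by apply: measurable_funB.
pose phi : {mfun measurableTypeR R >-> measurableTypeR R} :=
  HB.pack (fun x : measurableTypeR R => x - c : measurableTypeR R)
    (isMeasurableFun.Build _ _ _ _ _ mphi).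
move=> mA; apply: (@lebesgue_measure_unique _ (pushforward mu phi)) => // X.
move=> [[a b] /= _ <-]; rewrite /pushforward.
have -> : phi @^-1` `]a, b] = `]a + c, b + c]%classic.
  by apply/seteqP; split => x /=; rewrite !in_itv/= ltrBrDr lerBlDr.
rewrite !lebesgue_measure_itv/= !lte_fin ltrD2r.
by case: ifP => // _; rewrite -!EFinB; congr EFin; ring.
Qed.

Lemma integrable_on_shift a b c f : integrable_on a b f ->
  integrable_on (a + c) (b + c) (fun x => f (x - c)) /\
  rint (a + c) (b + c) (fun x => f (x - c)) = rint a b f.
Proof.
move=> fi; pose phi (x : measurableTypeR R) : measurableTypeR R := x - c.
have mphi : measurable_fun setT phi by apply: measurable_funB.
pose F := EFin \o (f \_ `[a, b]).
have Fi : mu.-integrable setT F.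
  by rewrite /F -restrict_EFin -integrable_restrict// setTI.
have FphiE : F \o phi = (EFin \o (fun x => f (x - c))) \_ `[a + c, b + c].
  rewrite restrict_EFin; apply/funext => x; rewrite /F /= !patchE !mem_setE !in_itv/=.
  by rewrite /phi lerBrDr lerBlDr.
have mF := measurable_int mu Fi.
have push (g : measurableTypeR R -> \bar R) : measurable_fun setT g -> (forall x, 0 <= g x)%E ->
    (\int[mu]_x g x = \int[mu]_x (g \o phi) x)%E.
  move=> mg g0; have := ge0_integral_pushforward mphi mu (D := setT) (f := g).
  rewrite preimage_setT => <-//.
  by apply: eq_measure_integral => A mA _; exact: pushforward_shift.
have Fphii : mu.-integrable setT (F \o phi).
  apply/integrableP; split; first exact: measurableT_comp mF mphi.
  rewrite -(push (fun x => `|F x|%E))//; last exact: measurableT_comp.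
  by case/integrableP : Fi.
split.
  move: Fphii; rewrite FphiE -integrable_restrict//.
  by rewrite setTI.
rewrite /rint /Rintegral; congr fine.
transitivity (\int[mu]_x (F \o phi) x)%E; first by rewrite FphiE -integral_mkcond.
transitivity (\int[mu]_x F x)%E; last by rewrite /F -restrict_EFin -integral_mkcond.
have := @integral_pushforward _ _ _ _ _ phi mphi mu setT F mF.
rewrite preimage_setT => <-//.
by apply: eq_measure_integral => A mA _; apply/esym; exact: pushforward_shift.
Qed.

(** At the junction l the second function takes over; the two agree there in
    all uses on continuous functions. *)
Definition juxtapose l f g x := if x < l then f x else g (x - l).

Lemma juxtapose_integrable l l' f g : 0 <= l -> 0 <= l' ->
  integrable_on 0 l f -> integrable_on 0 l' g ->
  integrable_on 0 (l + l') (juxtapose l f g) /\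
  rint 0 (l + l') (juxtapose l f g) = rint 0 l f + rint 0 l' g.
Proof.
move=> l0 l'0 fi gi; have [] := integrable_on_shift l gi.
rewrite add0r addrC => gli gl.
have jf x : 0 < x < l -> f x = juxtapose l f g x by move=> /andP[_]; rewrite /juxtapose => ->.
have jg x : l <= x <= l + l' -> g (x - l) = juxtapose l f g x.
  by move=> /andP[]; rewrite /juxtapose leNgt => /negbTE ->.
have jfi := eq_integrable_on_oo jf fi.
have jgi := eq_integrable_on jg gli.
have ll : 0 <= l <= l + l' by rewrite l0 lerDl.
have ji := integrable_on_union ll jfi jgi; split=> //.
by rewrite (rint_split ll ji) -(eq_rint_oo jf fi) -(eq_rint jg) gl.
Qed.

Lemma juxtapose_abs_cont l l' u v du dv : 0 <= l -> 0 <= l' -> u l = v 0 ->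
  abs_cont 0 l u du -> abs_cont 0 l' v dv ->
  abs_cont 0 (l + l') (juxtapose l u v) (juxtapose l du dv).
Proof.
move=> l0 l'0 uv [ui eu] [vi ev]; split; first exact: (juxtapose_integrable l0 l'0 ui vi).1.
have j0 : juxtapose l u v 0 = u 0.
  rewrite /juxtapose; case: ltP => // l0'.
  have lE : l = 0 by apply/le_anti; rewrite l0 l0'.
  by rewrite lE subrr -uv lE.
move=> x /andP[x0 xl]; rewrite j0 /juxtapose; case: ltP => lx.
  rewrite eu ?x0 ?(ltW lx)//; congr (_ + _); apply: eq_rint => y /andP[_ yx].
  by rewrite (le_lt_trans yx lx).
have xl0 : 0 <= x - l by rewrite subr_ge0.
have xll' : x - l <= l' by rewrite lerBlDl.
have vxi : integrable_on 0 (x - l) dv by exact: integrable_on_sub vi.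
have [_] := juxtapose_integrable l0 xl0 ui vxi.
rewrite addrCA subrr addr0 => ->.
rewrite ev ?xl0// -uv eu ?l0 ?lexx//; ring.
Qed.

Variables (I : eqType) (len : I -> R).
Hypothesis len0 : forall i, 0 <= len i.

(** Beyond the total length the glued function is 0, which is also the value of the
    functions U of the eigenfunctions at both ends of every edge. *)
Fixpoint glue (s : seq I) (phi : I -> R -> R) : R -> R :=
  if s is i :: s' then juxtapose (len i) (phi i) (glue s' phi) else fun=> 0.

Implicit Types (s : seq I) (phi dphi : I -> R -> R).

(** The hypothesis on P concerns the region beyond the last edge. *)
Lemma glue_comp (P : R -> R) s phi x : P 0 = 0 ->
  glue s (fun i x => P (phi i x)) x = P (glue s phi x).
Proof.
move=> P0; elim: s x => //= i s IH x; rewrite /juxtapose.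
by case: ifP => // _; rewrite IH.
Qed.

Lemma glue_sum (J : finType) s (phi : J -> I -> R -> R) x :
  glue s (fun i x => \sum_j phi j i x) x = \sum_j glue s (phi j) x.
Proof.
elim: s x => [|i s IH] x /=; first by rewrite big1.
by rewrite /juxtapose; case: ifP => // _; rewrite IH.
Qed.

Lemma glue_scale k s phi x : glue s (fun i x => k * phi i x) x = k * glue s phi x.
Proof. by rewrite (@glue_comp ( *%R k)) ?mulr0. Qed.

Lemma glue_integral s phi :
  (forall i, integrable_on 0 (len i) (phi i)) ->
  integrable_on 0 (\sum_(i <- s) len i) (glue s phi) /\
  rint 0 (\sum_(i <- s) len i) (glue s phi) = \sum_(i <- s) rint 0 (len i) (phi i).
Proof.
move=> phii; elim: s => [|i s [IH1 IH2]] /=.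
  by rewrite !big_nil rint0; split => //; exact: integrable_on_cst.
rewrite !big_cons -IH2; apply: juxtapose_integrable => //.
exact: sumr_ge0.
Qed.

Lemma glue_abs_cont s phi dphi :
  (forall i, abs_cont 0 (len i) (phi i) (dphi i)) ->
  (forall i, phi i 0 = 0) -> (forall i, phi i (len i) = 0) ->
  [/\ abs_cont 0 (\sum_(i <- s) len i) (glue s phi) (glue s dphi),
      glue s phi 0 = 0 & glue s phi (\sum_(i <- s) len i) = 0].
Proof.
move=> ac phi0 phil; elim: s => [|i s [IH1 IH2 IH3]] /=.
  by rewrite !big_nil; split => //; exact: abs_cont_cst.
have S0 : 0 <= \sum_(j <- s) len j by exact: sumr_ge0.
rewrite !big_cons; split.
- by apply: juxtapose_abs_cont => //; rewrite phil IH2.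
- rewrite /juxtapose; case: ltP => // li0.
  have -> : len i = 0 by apply/le_anti; rewrite li0 len0.
  by rewrite subrr.
- by rewrite /juxtapose ltNge lerDl S0/= [_ + _ - _]addrAC subrr add0r.
Qed.

End Gluing.

(** * The dimension argument for real vector-valued functions *)

Lemma exists_annihilated (F : fieldType) (J K : finType) (M : J -> K -> F) :
  (#|K| < #|J|)%N ->
  exists2 y : J -> F, (exists j, y j != 0) & forall k, \sum_j y j * M j k = 0.
Proof.
move=> KJ; pose A := \matrix_(i < #|J|, k < #|K|) M (enum_val i) (enum_val k).
have : kermx A != 0.
  rewrite kermx_eq0 /row_free; apply/negP => /eqP rA.
  by have := rank_leq_col A; rewrite rA leqNgt KJ.
case/rowV0Pn => v /sub_kermxP vA v0.
exists (fun j => v 0 (enum_rank j)).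
  have /rV0Pn[i vi] := v0; exists (enum_val i); by rewrite enum_valK.
move=> k; transitivity ((v *m A) 0 (enum_rank k)); last by rewrite vA mxE.
rewrite mxE (reindex _ (onW_bij _ (enum_val_bij J))).
by apply: eq_bigr => i _; rewrite !mxE enum_valK enum_rankK.
Qed.

Section VectorFunctions.
Context {R : realType} (E : finType) (len : E -> R).
Hypothesis len_gt0 : forall e, 0 < len e.
Let len_ge0 e : 0 <= len e. Proof. exact/ltW/len_gt0. Qed.

(** A complex function on a graph, seen as a real function on twice as many
    edges: the boolean false selects the real part, true the imaginary part. *)
Definition vfun := E -> bool -> R -> R.
Implicit Types (phi psi f U dU : vfun).

Definition vint phi : R := \sum_e \sum_b rint 0 (len e) (phi e b).

Definition vdot phi psi := vint (fun e b x => phi e b x * psi e b x).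

Definition square_integrable phi :=
  forall e b, sq_integrable_on 0 (len e) (phi e b).

Lemma vdotC phi psi : vdot phi psi = vdot psi phi.
Proof.
by apply: eq_bigr => e _; apply: eq_bigr => b _; apply: eq_rint => x _; rewrite mulrC.
Qed.

Lemma eq_vdot phi1 psi1 phi2 psi2 :
  (forall e b x, 0 <= x <= len e -> phi1 e b x = phi2 e b x) ->
  (forall e b x, 0 <= x <= len e -> psi1 e b x = psi2 e b x) ->
  vdot phi1 psi1 = vdot phi2 psi2.
Proof.
move=> h1 h2; apply: eq_bigr => e _; apply: eq_bigr => b _.
by apply: eq_rint => x xe; rewrite h1// h2.
Qed.

Lemma vdotDl phi1 phi2 psi : square_integrable phi1 -> square_integrable phi2 ->
  square_integrable psi ->
  vdot (fun e b x => phi1 e b x + phi2 e b x) psi = vdot phi1 psi + vdot phi2 psi.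
Proof.
move=> h1 h2 h3; rewrite /vdot /vint -big_split; apply: eq_bigr => e _ /=.
rewrite -big_split; apply: eq_bigr => b _ /=.
rewrite -rintD; [|exact: sq_integrable_onM|exact: sq_integrable_onM].
by apply: eq_rint => x _; rewrite mulrDl.
Qed.

Lemma vdotZl k phi psi : square_integrable phi -> square_integrable psi ->
  vdot (fun e b x => k * phi e b x) psi = k * vdot phi psi.
Proof.
move=> h1 h2; rewrite /vdot /vint mulr_sumr; apply: eq_bigr => e _ /=.
rewrite mulr_sumr; apply: eq_bigr => b _ /=.
rewrite -rintZ; last exact: sq_integrable_onM.
by apply: eq_rint => x _; rewrite mulrA.
Qed.

Lemma vdotBl phi1 phi2 psi : square_integrable phi1 -> square_integrable phi2 ->
  square_integrable psi ->
  vdot (fun e b x => phi1 e b x - phi2 e b x) psi = vdot phi1 psi - vdot phi2 psi.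
Proof.
move=> h1 h2 h3; rewrite -mulN1r -vdotZl// -vdotDl//; last first.
  by move=> e b; exact: sq_integrable_onZ.
by apply: eq_vdot => // e b x _; rewrite mulN1r.
Qed.

Lemma vdot_subr_sqr phi psi : square_integrable phi -> square_integrable psi ->
  vdot (fun e b x => phi e b x - psi e b x) (fun e b x => phi e b x - psi e b x) =
  vdot phi phi - 2 * vdot psi phi + vdot psi psi.
Proof.
move=> h1 h2; have h3 : square_integrable (fun e b x => phi e b x - psi e b x).
  by move=> e b; exact: sq_integrable_onB.
rewrite vdotBl// (vdotC phi) (vdotC psi (fun e b x => _ - _)) !vdotBl//.
by rewrite (vdotC phi psi); ring.
Qed.

Definition comb (I : finType) (c : I -> R) (phi : I -> vfun) : vfun :=
  fun e b x => \sum_i c i * phi i e b x.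

Lemma square_integrable_comb (I : finType) c (phi : I -> vfun) :
  (forall i, square_integrable (phi i)) -> square_integrable (comb c phi).
Proof.
move=> h e b; apply: sq_integrable_on_sum => i; apply: sq_integrable_onZ; exact: h.
Qed.

Lemma vdot_combl (I : finType) c (phi : I -> vfun) psi :
  (forall i, square_integrable (phi i)) -> square_integrable psi ->
  vdot (comb c phi) psi = \sum_i c i * vdot (phi i) psi.
Proof.
move=> h hp; under [RHS]eq_bigr => i _ do rewrite -vdotZl//.
rewrite /vdot /vint [RHS]exchange_big; apply: eq_bigr => e _ /=.
rewrite [RHS]exchange_big; apply: eq_bigr => b _ /=.
rewrite -rint_sum; last first.
  by move=> i; apply: sq_integrable_onM => //; apply: sq_integrable_onZ; exact: h.
by apply: eq_rint => x _; rewrite mulr_suml.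
Qed.

Lemma vdot_combr (I : finType) c (phi : I -> vfun) psi :
  (forall i, square_integrable (phi i)) -> square_integrable psi ->
  vdot psi (comb c phi) = \sum_i c i * vdot psi (phi i).
Proof.
move=> h hp; rewrite vdotC vdot_combl//.
by apply: eq_bigr => i _; rewrite vdotC.
Qed.

Lemma vdot_ge0 phi : 0 <= vdot phi phi.
Proof.
do 2 (apply: sumr_ge0 => ? _); apply: rint_ge0 => x _.
by rewrite -expr2 sqr_ge0.
Qed.

Lemma vdot_eq0 phi : square_integrable phi -> vdot phi phi <= 0 ->
  forall e b, ae_eq_on 0 (len e) (phi e b) (fun=> 0).
Proof.
move=> h p0 e b; apply: rint_sqr_eq0 => //.
have p00 : vdot phi phi = 0 by apply/le_anti; rewrite p0 vdot_ge0.
have ge0 e' b' : 0 <= rint 0 (len e') (fun x => phi e' b' x * phi e' b' x).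
  by apply: rint_ge0 => x _; rewrite -expr2 sqr_ge0.
have /psumr_eq0P := p00.
move=> /(_ (fun e' _ => sumr_ge0 _ (fun b' _ => ge0 e' b')))/(_ e isT).
move/psumr_eq0P => /(_ (fun b' _ => ge0 e b'))/(_ b isT).
by move=> r0; rewrite (eq_rint (g := fun x => phi e b x * phi e b x)) ?r0.
Qed.

End VectorFunctions.

(** In this section f i, U i and dU i stand for the real coordinates of an
    eigenfunction of the Krein Laplacian for the eigenvalue lam i, of its component
    in the domain of the minimal operator, and of the derivative of the latter.
    The hypotheses collect what is known about them; f i - U i is the component in
    the kernel of the adjoint, and independence is only assumed inside each
    eigenspace. *)
Section RayleighBound.
Context {R : realType} (E : finType) (len : E -> R).
Hypothesis len_gt0 : forall e, 0 < len e.
Let len_ge0 e : 0 <= len e. Proof. exact/ltW/len_gt0. Qed.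
Variables (I : finType) (f U dU : I -> @vfun R E) (lam : I -> R).
Hypothesis f2 : forall i, square_integrable len (f i).
Hypothesis acU : forall i e b, abs_cont 0 (len e) (U i e b) (dU i e b).
Hypothesis acdU : forall i e b,
  abs_cont 0 (len e) (dU i e b) (fun x => - lam i * f i e b x).
Hypothesis U0 : forall i e b, U i e b 0 = 0.
Hypothesis Ul : forall i e b, U i e b (len e) = 0.
Hypothesis lam_gt0 : forall i, 0 < lam i.
Hypothesis f_orth_ker : forall i j,
  vdot len (f i) (fun e b x => f j e b x - U j e b x) = 0.
Hypothesis f_mean0 : forall i b, \sum_e rint 0 (len e) (f i e b) = 0.
Hypothesis f_free : forall (c : I -> R) m, (forall i, c i != 0 -> lam i = m) ->
  (forall e b, ae_eq_on 0 (len e) (comb c f e b) (fun=> 0)) ->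
  forall i, c i = 0.

Local Notation dot := (vdot len).

Let U2 i : square_integrable len (U i).
Proof. by move=> e b; exact: abs_cont_sq_integrable (acU i e b). Qed.

Let dU2 i : square_integrable len (dU i).
Proof. by move=> e b; exact: abs_cont_sq_integrable (acdU i e b). Qed.

Let G i j := dot (f i) (f j).

Lemma dot_fU i j : dot (f i) (U j) = G i j.
Proof.
apply/eqP; rewrite -subr_eq0 -oppr_eq0 opprB /G; apply/eqP.
rewrite -[RHS](f_orth_ker i j) vdotC [dot _ (U j)]vdotC -vdotBl// vdotC//.
Qed.

(** Integration by parts, the boundary terms vanish since U j does. *)
Lemma dot_dU i j : dot (dU i) (dU j) = lam i * G i j.
Proof.
rewrite -dot_fU -vdotZl//; apply: eq_bigr => e _; apply: eq_bigr => b _.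
have := abs_cont_by_parts (len_ge0 e) (acdU i e b) (acU j e b).
rewrite Ul U0 !mulr0 subrr rintD.
- move/eqP; rewrite addr_eq0 => /eqP ->; rewrite -rintN; last first.
    exact: abs_cont_integrableM (acU j e b) (acdU i e b).1.
  by apply: eq_rint => x _; ring.
- exact: sq_integrable_onM (dU2 i e b) (dU2 j e b).
- exact: abs_cont_integrableM (acU j e b) (acdU i e b).1.
Qed.

Lemma lam_gram i j : lam i * G i j = lam j * G i j.
Proof. by rewrite -dot_dU vdotC dot_dU /G vdotC. Qed.

(** The Gram matrix G commutes with the diagonal matrix lam, so that
    t G - lam G is the Gram matrix of the functions sqrt (t - lam i) f i. *)
Lemma energy_le c t : (forall i, lam i <= t) ->
  dot (comb c dU) (comb c dU) <= t * dot (comb c f) (comb c f).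
Proof.
move=> lt; pose d i := Num.sqrt (t - lam i) * c i.
have E0 i j : d i * d j * G i j = (t - lam i) * (c i * c j * G i j).
  have [Gij|Gij] := eqVneq (G i j) 0; first by rewrite Gij !mulr0.
  have lij : lam i = lam j by apply: (mulIf Gij); exact: lam_gram.
  have := sqr_sqrtr (_ : 0 <= t - lam i); rewrite subr_ge0 lt => /(_ isT) s.
  by rewrite /d -lij -[X in _ = X * _]s; ring.
have quad (k : I -> R) (phi : I -> @vfun R E) : (forall i, square_integrable len (phi i)) ->
    dot (comb k phi) (comb k phi) = \sum_i \sum_j k i * k j * dot (phi i) (phi j).
  move=> h; rewrite vdot_combl//; last exact: square_integrable_comb.
  apply: eq_bigr => i _; rewrite vdot_combr// mulr_sumr.
  by apply: eq_bigr => j _; rewrite mulrA.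
have Q0 := vdot_ge0 len (comb d f).
rewrite quad// in Q0; rewrite !quad// -subr_ge0 mulr_sumr -sumrB; apply: (le_trans Q0).
rewrite le_eqVlt; apply/orP; left; apply/eqP.
apply: eq_bigr => i _; rewrite mulr_sumr -sumrB; apply: eq_bigr => j _.
by rewrite -/(G i j) E0 dot_dU; ring.
Qed.

(** Eigenfunctions for distinct eigenvalues are orthogonal, so each eigencomponent
    of a vanishing combination vanishes. *)
Lemma comb_free c : dot (comb c f) (comb c f) <= 0 -> forall i, c i = 0.
Proof.
move=> c0 i; pose ci j := if lam j == lam i then c j else 0.
have F2 := square_integrable_comb c f2; have Fi2 := square_integrable_comb ci f2.
have orth : dot (comb ci f) (fun e b x => comb c f e b x - comb ci f e b x) = 0.
  rewrite vdotC vdotBl//; rewrite ![dot _ (comb ci f)]vdot_combr//.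
  rewrite -sumrB big1// => j _; rewrite -mulrBr.
  rewrite /ci; case: eqP => [ji|]; last by rewrite mul0r.
  rewrite !vdot_combl// -sumrB big1 ?mulr0// => k _; rewrite -mulrBl.
  case: eqP => [_|ki]; first by rewrite subrr mul0r.
  have := lam_gram k j; rewrite ji => /eqP; rewrite -subr_eq0 -mulrBl mulf_eq0 subr_eq0.
  by move=> /orP[/eqP//|/eqP]; rewrite /G => ->; rewrite mulr0.
have Fi0 : dot (comb ci f) (comb ci f) <= 0.
  apply: le_trans c0; rewrite -subr_ge0.
  have := vdot_ge0 len (fun e b x => comb c f e b x - comb ci f e b x).
  rewrite vdot_subr_sqr//; move: orth; rewrite vdotC vdotBl// [dot _ (comb ci f)]vdotC.
  by move=> o1 o2; lra.
have := f_free (m := lam i) (c := ci) _ (vdot_eq0 Fi2 Fi0) i.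
rewrite /ci eqxx; apply => j; by case: (lam j =P lam i) => // _; rewrite eqxx.
Qed.

Let L := \sum_e len e.

(** Counted over the reals, the functions comb c U - ka form a space of dimension
    #|I| + 2, where ka is one constant for the real and one for the imaginary part.
    The alternating conditions on both glued parts are 2 (2 m - 1) in number, so
    some nonzero element satisfies them all, and its Rayleigh quotient is at most t
    and at least nu ^ 2. *)
Lemma rayleigh_loop_bound (m : nat) t : (0 < m)%N -> (0 < #|E|)%N ->
  (2 * (m.*2.-1) < #|I| + 2)%N -> (forall i, lam i <= t) ->
  (pi * m.*2%:R / L) ^+ 2 <= t.
Proof.
move=> m0 E0 mI lamt; set nu := pi * _ / _.
pose s := enum E.
have sL : \sum_(e <- s) len e = L by rewrite /s big_enum.
have L0 : 0 < L.
  have /card_gt0P[e _] := E0; rewrite /L (bigD1 e)//= ltr_pwDl//.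
  exact: sumr_ge0.
pose W i b := glue len s (fun e => U i e b).
pose dW i b := glue len s (fun e => dU i e b).
(* The condition at the point 0 is void, whence the shift q.2.+1 below; a constant
   contributes - ka to w at every point. *)
pose pt (k : nat) : R := k%:R * (L / m.*2%:R).
pose M (j : I + bool) (q : bool * 'I_(m.*2.-1)) : R :=
  match j with
  | inl i => W i q.1 (pt q.2.+1) - (-1) ^+ q.2.+1 * W i q.1 0
  | inr b => - (b == q.1)%:R * (1 - (-1) ^+ q.2.+1)
  end.
have [|y [j0 yj0] yM] := exists_annihilated M.
  by rewrite card_prod card_bool card_ord card_sum card_bool.
pose c i := y (inl i); pose ka b := y (inr b).
pose w b x := \sum_i c i * W i b x - ka b.
pose dw b x := \sum_i c i * dW i b x.
have Wspec i b : [/\ abs_cont 0 L (W i b) (dW i b), W i b 0 = 0 & W i b L = 0].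
  by rewrite -sL; exact: glue_abs_cont.
have Wglue b x : \sum_i c i * W i b x = glue len s (fun e => comb c U e b) x.
  by rewrite glue_sum; apply: eq_bigr => i _; rewrite glue_scale.
have dWglue b x : dw b x = glue len s (fun e => comb c dU e b) x.
  by rewrite glue_sum; apply: eq_bigr => i _; rewrite glue_scale.
have w0 b : w b 0 = - ka b.
  rewrite /w big1 ?sub0r// => i _; have [_ -> _] := Wspec i b; exact: mulr0.
have acw b : abs_cont 0 L (w b) (dw b).
  have h : abs_cont 0 L (fun x => \sum_i c i * W i b x) (dw b).
    by apply: abs_cont_sum => i; apply: abs_contZ; case: (Wspec i b).
  have := abs_contB h (abs_cont_cst 0 L (ka b)).
  by apply: eq_abs_cont => //; [exact: ltW|move=> x _; rewrite subr0].
have intdw b : integrable_on 0 L (fun x => dw b x ^+ 2) /\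
    rint 0 L (fun x => dw b x ^+ 2) = \sum_e rint 0 (len e) (fun x => comb c dU e b x ^+ 2).
  have [] := @glue_integral R E len len_ge0 s (fun e x => comb c dU e b x ^+ 2).
    by move=> e; case: (square_integrable_comb c dU2 e b).
  rewrite sL big_enum/= => h1 h2.
  have h x : glue len s (fun e x => comb c dU e b x ^+ 2) x = dw b x ^+ 2.
    by rewrite dWglue (@glue_comp _ _ _ (fun z => z ^+ 2)) ?expr0n.
  split; first by apply: eq_integrable_on h1 => x _; rewrite h.
  by rewrite -h2; apply: eq_rint => x _; rewrite h.
have intw b : rint 0 L (fun x => w b x ^+ 2) =
    \sum_e rint 0 (len e) (fun x => (comb c U e b x - ka b) ^+ 2).
  have U2c e : sq_integrable_on 0 (len e) (comb c U e b) by exact: square_integrable_comb.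
  have [] := @glue_integral R E len len_ge0 s (fun e => comb c U e b).
    by move=> e; exact: sq_integrable_onW.
  have [] := @glue_integral R E len len_ge0 s (fun e x => comb c U e b x ^+ 2).
    by move=> e; case: (U2c e).
  rewrite sL !big_enum/=; set g := glue len s (fun e => comb c U e b) => q1 q2 g1 g2.
  have h x : glue len s (fun e x => comb c U e b x ^+ 2) x = g x ^+ 2.
    by rewrite (@glue_comp _ _ _ (fun z => z ^+ 2)) ?expr0n.
  have expand l (p : R -> R) : 0 <= l -> integrable_on 0 l p ->
      integrable_on 0 l (fun x => p x ^+ 2) ->
      rint 0 l (fun x => (p x - ka b) ^+ 2) = rint 0 l (fun x => p x ^+ 2) +
        (- 2 * ka b * rint 0 l p + ka b ^+ 2 * l).
    move=> l0 p1 p2; have := rint_cst (ka b ^+ 2) l0; rewrite subr0 => <-.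
    rewrite -rintZ// -!rintD//.
    - by apply: eq_rint => x _; ring.
    - by apply: integrable_onD; [exact: integrable_onZ|exact: integrable_on_cst].
    - exact: integrable_onZ.
    - exact: integrable_on_cst.
  have -> : rint 0 L (fun x => w b x ^+ 2) = rint 0 L (fun x => (g x - ka b) ^+ 2).
    by apply: eq_rint => x _; rewrite /w Wglue.
  rewrite expand//; last 2 first.
  - exact: ltW.
  - by apply: eq_integrable_on q1 => x _; rewrite h.
  rewrite (eq_rint (g := glue len s (fun e x => comb c U e b x ^+ 2))); last first.
    by move=> x _; rewrite h.
  rewrite q2 g2 /L !mulr_sumr -!big_split/=; apply: eq_bigr => e _.
  rewrite expand//; [exact: sq_integrable_onW|by case: (U2c e)].
have ww b : nu ^+ 2 * rint 0 L (fun x => w b x ^+ 2) <= rint 0 L (fun x => dw b x ^+ 2).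
  apply: wirtinger_alternating => //.
  - split; last by case: (intdw b).
    exact: integrable_on_measurable (acw b).1.
  - rewrite w0 /w big1 ?sub0r// => i _; have [_ _ ->] := Wspec i b; exact: mulr0.
  - case=> [|k kN]; first by rewrite mul0r expr0 mul1r.
    have kN' : (k < m.*2.-1)%N by rewrite -ltnS prednK// double_gt0.
    have := yM (b, Ordinal kN').
    rewrite big_sumType/= w0 -/(pt k.+1).
    rewrite [X in _ + X](bigD1 b)//= [X in _ + (_ + X)]big1 ?addr0; last first.
      by move=> b' /negbTE bb'; rewrite bb' oppr0 mul0r mulr0.
    rewrite eqxx mulN1r mulrN.
    have Wi0 i : W i b 0 = 0 by case: (Wspec i b).
    under eq_bigr => i _ do rewrite Wi0 mulr0 subr0 -/(c i).
    by move=> /eqP; rewrite subr_eq0 => /eqP e; rewrite /w e -/(ka b); ring.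
pose wE e b x := comb c U e b x - ka b.
have wE2 : square_integrable len wE.
  move=> e b; apply: sq_integrable_onB; first exact: square_integrable_comb.
  exact: sq_integrable_on_cst.
have F2 := square_integrable_comb c f2.
have main : nu ^+ 2 * dot wE wE <= dot (comb c dU) (comb c dU).
  rewrite /vdot /vint exchange_big [leRHS]exchange_big mulr_sumr/=.
  apply: ler_sum => b _.
  by have := ww b; rewrite intw (intdw b).2.
have Fw : dot (comb c f) (comb c f) <= dot wE wE.
  have FwE : dot (comb c f) wE = dot (comb c f) (comb c f).
    rewrite vdotC vdotBl//; last 2 first.
    - exact: square_integrable_comb.
    - by move=> e b; exact: sq_integrable_on_cst.
    rewrite [X in _ - X](_ : _ = 0) ?subr0; last first.
      rewrite vdotC vdot_combl//; last by move=> e b; exact: sq_integrable_on_cst.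
      rewrite big1// => i _; rewrite /vdot /vint exchange_big big1 ?mulr0// => b _ /=.
      under eq_bigr => e _ do (under eq_rint => x _ do rewrite mulrC).
      under eq_bigr => e _ do (rewrite rintZ; last exact: sq_integrable_onW (f2 i e b)).
      by rewrite -mulr_sumr f_mean0 mulr0.
    rewrite vdotC !vdot_combl//; last exact: square_integrable_comb.
    apply: eq_bigr => i _; rewrite !vdot_combr//; congr (_ * _).
    by apply: eq_bigr => k _; rewrite dot_fU.
  have := vdot_ge0 len (fun e b x => wE e b x - comb c f e b x).
  by rewrite vdot_subr_sqr// FwE => h; lra.
(* If t < nu ^ 2, then w = 0, hence f = 0 and the chosen element is zero. *)
rewrite leNgt; apply/negP => tnu.
have w00 : dot wE wE <= 0.
  have := le_trans main (energy_le c lamt).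
  have /card_gt0P[i0 _] : (0 < #|I|)%N by clear -mI m0; lia.
  have t0 : 0 <= t by exact: le_trans (ltW (lam_gt0 i0)) (lamt i0).
  move=> h; rewrite leNgt; apply/negP => w0p.
  have := lt_le_trans (_ : t * dot wE wE < nu ^+ 2 * dot wE wE) h.
  by rewrite ltr_pM2r// => /(_ tnu); rewrite ltNge ler_wpM2l.
have c0 := comb_free (le_trans Fw w00).
have ka0 b : ka b = 0.
  have /card_gt0P[e _] := E0.
  have := w00; rewrite leNgt => /negP wn; apply/eqP/negPn/negP => kb; apply: wn.
  have ge0 e' b' : 0 <= rint 0 (len e') (fun x => wE e' b' x * wE e' b' x).
    by apply: rint_ge0 => x _; rewrite -expr2 sqr_ge0.
  rewrite /vdot /vint (bigD1 e)//= ltr_pwDl//; last first.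
    by apply: sumr_ge0 => e' _; exact: sumr_ge0.
  rewrite (bigD1 b)//= ltr_pwDl//; last exact: sumr_ge0.
  rewrite (eq_rint (g := fun=> ka b ^+ 2)).
    by rewrite rint_cst// subr0 mulr_gt0// exprn_even_gt0.
  move=> x _; rewrite /wE /comb big1; first by ring.
  by move=> i _; rewrite c0 mul0r.
move: yj0; case: j0 => [i|b]; first by rewrite -/(c i) c0 eqxx.
by rewrite -/(ka b) ka0 eqxx.
Qed.

End RayleighBound.

Local Open Scope complex_scope.

(** * Regularity of weak second derivatives *)

Section WeakSecondDerivative.
Context {R : realType}.
Implicit Types (l a b x : R) (p q psi : R -> R).

Definition primitive p x := rint 0 x p.

Lemma primitive0 p : primitive p 0 = 0. Proof. exact: rint_pt. Qed.

Lemma abs_cont_primitive2 l p : 0 <= l -> integrable_on 0 l p ->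
  abs_cont 0 l (primitive (primitive p)) (primitive p).
Proof.
move=> l0 pi; apply: abs_cont_primitive => //.
exact: abs_cont_integrable (abs_cont_primitive l0 pi).
Qed.

(** The form of a solution of p'' = - q. *)
Definition ae_affine_minus l p q :=
  exists a b, ae_eq_on 0 l p (fun x => a + b * x - primitive (primitive q) x).

(** The test functions are the second primitives of the psi orthogonal to 1 and x,
    which vanish with their derivatives at both ends.  Two integrations by parts
    turn the hypothesis into the orthogonality of r = p + (second primitive of q)
    to all these psi.  The remainder psi of the projection of r onto the affine
    functions is one of them, so it is orthogonal to itself. *)
Lemma weak_second_derivative l p q : 0 < l ->
  sq_integrable_on 0 l p -> sq_integrable_on 0 l q ->
  (forall psi, sq_integrable_on 0 l psi -> primitive psi l = 0 ->
     primitive (primitive psi) l = 0 ->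
     rint 0 l (fun x => primitive (primitive psi) x * q x) =
     - rint 0 l (fun x => psi x * p x)) ->
  ae_affine_minus l p q.
Proof.
move=> l0 p2 q2 H; have l0' := ltW l0.
have q1 := abs_cont_primitive l0' (sq_integrable_onW q2).
have Q := abs_cont_primitive2 l0' (sq_integrable_onW q2).
pose r x := p x + primitive (primitive q) x.
have r2 : sq_integrable_on 0 l r.
  by apply: sq_integrable_onD => //; exact: abs_cont_sq_integrable Q.
pose y x : R := 1 * (x - l / 2).
have hy : abs_cont 0 l y (fun=> 1) by exact: abs_cont_affine.
have y2 := abs_cont_sq_integrable l0' hy.
(* The functions 1 and y = x - l / 2 are orthogonal with squared norms l and
   l ^ 3 / 12. *)
pose A := rint 0 l r / l; pose B := rint 0 l (fun x => y x * r x) / (l ^+ 3 / 12).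
pose psi x := r x - A - B * y x.
have psi2 : sq_integrable_on 0 l psi.
  apply: sq_integrable_onB; last exact: sq_integrable_onZ.
  by apply: sq_integrable_onB => //; exact: sq_integrable_on_cst.
have int1 : rint 0 l (fun=> 1) = l by rewrite rint_cst// subr0 mul1r.
have inty : rint 0 l y = 0.
  have := abs_cont_by_parts l0' hy hy.
  rewrite (eq_rint (g := fun x => 2 * y x)); last by move=> x _; ring.
  rewrite rintZ; last exact: sq_integrable_onW.
  have -> : y l * y l - y 0 * y 0 = 0 by rewrite /y; field.
  by move/eqP; rewrite mulf_eq0 pnatr_eq0/= => /eqP.
have intyy : rint 0 l (fun x => y x * y x) = l ^+ 3 / 12.
  have := abs_cont_by_parts l0' hy (abs_contM l0' hy hy).
  rewrite (eq_rint (g := fun x => 3 * (y x * y x))); last by move=> x _; ring.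
  rewrite rintZ; last exact: sq_integrable_onM.
  by rewrite /y => h; lra.
have psi1 : rint 0 l psi = 0.
  have rA2 : sq_integrable_on 0 l (fun x => r x - A).
    by apply: sq_integrable_onB => //; exact: sq_integrable_on_cst.
  rewrite (rintB (sq_integrable_onW rA2) (integrable_onZ B (sq_integrable_onW y2))).
  rewrite rintB; [|exact: sq_integrable_onW|exact: integrable_on_cst].
  rewrite rintZ ?inty; last exact: sq_integrable_onW.
  by rewrite rint_cst// subr0 /A divfK ?lt0r_neq0// subrr mulr0 subrr.
have psiy : rint 0 l (fun x => y x * psi x) = 0.
  rewrite (eq_rint (g := fun x => y x * r x - (A * y x + B * (y x * y x)))); last first.
    by move=> x _; rewrite /psi; ring.
  have i1 : integrable_on 0 l (fun x => y x * r x) by exact: sq_integrable_onM.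
  have i2 : integrable_on 0 l (fun x => A * y x) by apply: integrable_onZ; exact: sq_integrable_onW.
  have i3 : integrable_on 0 l (fun x => y x * y x) by exact: sq_integrable_onM.
  rewrite rintB//; last by apply: integrable_onD => //; exact: integrable_onZ.
  rewrite rintD//; last exact: integrable_onZ.
  rewrite (rintZ A (sq_integrable_onW y2)) (rintZ B i3).
  rewrite inty intyy mulr0 add0r /B divfK ?subrr//.
  by rewrite lt0r_neq0// divr_gt0// exprn_gt0.
have P1 := abs_cont_primitive l0' (sq_integrable_onW psi2).
have P2 := abs_cont_primitive2 l0' (sq_integrable_onW psi2).
have P1i := abs_cont_integrable l0' P1.
have pl : primitive psi l = 0 by [].
have ppl : primitive (primitive psi) l = 0.
  have := abs_cont_by_parts l0' hy P1.
  rewrite -/(primitive psi l) -/(primitive psi 0) pl primitive0 !mulr0 subrr.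
  rewrite rintD.
  - rewrite psiy add0r (eq_rint (g := primitive psi))//.
    by move=> x _; rewrite mulr1.
  - exact: sq_integrable_onM.
  - by apply: eq_integrable_on P1i => x _; rewrite mulr1.
have e1 := H psi psi2 pl ppl.
have e2 := abs_cont_by_parts l0' P2 q1.
have e3 := abs_cont_by_parts l0' P1 Q.
rewrite -/(primitive (primitive psi) l) -/(primitive (primitive psi) 0) in e2.
rewrite ppl primitive0 !mul0r subrr in e2.
rewrite -/(primitive psi l) -/(primitive psi 0) pl primitive0 !mul0r subrr in e3.
rewrite rintD in e2; [|exact: abs_cont_integrableM P2 q1.1|exact: abs_cont_integrableM q1 P2.1].
rewrite rintD in e3; [|exact: abs_cont_integrableM P1 Q.1|exact: abs_cont_integrableM Q P1.1].
have psir : rint 0 l (fun x => psi x * r x) = 0.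
  rewrite (eq_rint (g := fun x => psi x * p x + primitive (primitive q) x * psi x)).
    rewrite rintD; [|exact: sq_integrable_onM|exact: abs_cont_integrableM Q P1.1].
    move: e1 e2 e3.
    rewrite (eq_rint (f := fun x => rint 0 x psi * primitive q x)
      (g := fun x => rint 0 x q * primitive psi x)).
      by rewrite /primitive => h1 h2 h3; lra.
    by move=> x _; rewrite mulrC.
  by move=> x _; rewrite /r; ring.
have : rint 0 l (fun x => psi x ^+ 2) <= 0.
  rewrite (eq_rint (g := fun x => psi x * r x - (A * psi x + B * (y x * psi x)))); last first.
    by move=> x _; rewrite /psi; ring.
  have i1 : integrable_on 0 l (fun x => psi x * r x) by exact: sq_integrable_onM.
  have i2 : integrable_on 0 l psi by exact: sq_integrable_onW.
  have i3 : integrable_on 0 l (fun x => y x * psi x) by exact: sq_integrable_onM.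
  rewrite rintB//; last by apply: integrable_onD; exact: integrable_onZ.
  rewrite rintD; [|exact: integrable_onZ|exact: integrable_onZ].
  by rewrite !rintZ// psir psi1 psiy !mulr0 addr0 subrr.
move/(rint_sqr_eq0 psi2) => h.
exists (A - B * (l / 2)), B; apply: filterS h => x + xl => /(_ xl).
rewrite /psi /r /y => h; lra.
Qed.

End WeakSecondDerivative.

(** * Real and imaginary parts *)

Section ComplexParts.
Context {R : realType}.
Local Notation mu := (@lebesgue_measure R).
Implicit Types (l : R) (f g u du ddu : R -> R[i]) (b : bool).

Definition part b (z : R[i]) : R := if b then complex.Im z else complex.Re z.

Lemma partP (z w : R[i]) : (forall b, part b z = part b w) -> z = w.
Proof. by case: z w => a b [c d] h; rewrite (h false : a = c) (h true : b = d). Qed.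

Lemma part0 b : part b 0 = 0. Proof. by case: b. Qed.

Lemma partD b z w : part b (z + w) = part b z + part b w.
Proof. by case: b; case: z w => ? ? []. Qed.

Lemma partN b z : part b (- z) = - part b z.
Proof. by case: b; case: z. Qed.

Lemma partB b z w : part b (z - w) = part b z - part b w.
Proof. by rewrite partD partN. Qed.

Lemma partZ b (k : R) z : part b (k%:C * z) = k * part b z.
Proof. by case: b; case: z => x y /=; rewrite mul0r ?addr0 ?subr0. Qed.

Lemma part_sum b (I : Type) (s : seq I) (P : pred I) (F : I -> R[i]) :
  part b (\sum_(i <- s | P i) F i) = \sum_(i <- s | P i) part b (F i).
Proof. by rewrite (big_morph _ (partD b) (part0 b)). Qed.

Lemma open_measurable_closed l (f : R -> R) :
  measurable_fun `]0, l[ f <-> measurable_fun `[0, l] f.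
Proof.
split; first exact: measurable_fun_itv_cc.
by apply: measurable_funS => //; exact: subset_itv_oo_cc.
Qed.

Lemma L2_onP l f : L2_on l f <-> forall b, sq_integrable_on 0 l (fun x => part b (f x)).
Proof.
split=> [[mr mi /integrable_on_oo fi] b|h].
  have mr' := (open_measurable_closed _ _).1 mr.
  have mi' := (open_measurable_closed _ _).1 mi.
  split; first by case: b.
  have : integrable_on 0 l (fun x => complex.Re (f x) ^+ 2 + complex.Im (f x) ^+ 2) by [].
  apply: integrable_on_le; first by case: b; exact: measurable_funX.
  move=> x _; rewrite ger0_norm ?sqr_ge0//.
  by case: b; rewrite /= ?lerDl ?lerDr sqr_ge0.
have [mr r2] := h false; have [mi i2] := h true.
split; [exact/open_measurable_closed|exact/open_measurable_closed|].
by apply/integrable_on_oo; exact: integrable_onD.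
Qed.

Lemma part_cintegral b (a c : R) f :
  part b (cintegral `[a, c] f) = rint a c (fun x => part b (f x)).
Proof. by case: b. Qed.

Lemma H1_repP l u du : H1_rep l u du <-> forall b,
  sq_integrable_on 0 l (fun x => part b (du x)) /\
  abs_cont 0 l (fun x => part b (u x)) (fun x => part b (du x)).
Proof.
split=> [[/L2_onP du2 eu] b|h].
  split => //; split; first exact: sq_integrable_onW.
  by move=> x xl; rewrite eu// partD part_cintegral.
split; first by apply/L2_onP => b; case: (h b).
move=> x xl; apply: partP => b; rewrite partD part_cintegral.
by have [_ [_ ->]] := h b.
Qed.

Lemma part_cintegral_mul_conj b l f g :
  (forall b, sq_integrable_on 0 l (fun x => part b (f x))) ->
  (forall b, sq_integrable_on 0 l (fun x => part b (g x))) ->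
  part b (cintegral `]0, l[ (fun x => f x * (g x)^*)) =
  if b then rint 0 l (fun x => part true (f x) * part false (g x)) -
            rint 0 l (fun x => part false (f x) * part true (g x))
       else rint 0 l (fun x => part false (f x) * part false (g x)) +
            rint 0 l (fun x => part true (f x) * part true (g x)).
Proof.
move=> f2 g2.
have i b1 b2 : integrable_on 0 l (fun x => part b1 (f x) * part b2 (g x)).
  exact: sq_integrable_onM.
have o p q : (forall x, p x = q x) -> integrable_on 0 l q ->
    \int[mu]_(x in `]0, l[) p x = rint 0 l q.
  move=> pq qi; have -> : p = q by exact/funext.
  rewrite rint_oo//; apply/open_measurable_closed; exact: integrable_on_measurable qi.
case: b.
  rewrite -(rintB (i true false) (i false true)).
  apply: o; last exact: integrable_onB (i true false) (i false true).
  by move=> x; case: (f x) (g x) => ? ? [? ?] /=; ring.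
rewrite -(rintD (i false false) (i true true)).
apply: o; last exact: integrable_onD (i false false) (i true true).
by move=> x; case: (f x) (g x) => ? ? [? ?] /=; ring.
Qed.

End ComplexParts.

Section GraphFunctions.
Context {R : realType} {G : metric_graph R}.
Local Notation mu := (@lebesgue_measure R).
Implicit Types (f g h u du ddu w : gfun G) (T : operator G).

Definition parts f : @vfun R (edge G) := fun e b x => part b (f e x).

Definition of_parts (phi : @vfun R (edge G)) : gfun G :=
  fun e x => phi e false x +i* phi e true x.

Lemma part_of_parts phi e b x : part b (of_parts phi e x) = phi e b x.
Proof. by case: b. Qed.

Lemma of_partsK phi : parts (of_parts phi) = phi.
Proof. by apply/funext => e; apply/funext => -[]. Qed.

Lemma L2P f : L2 f <-> square_integrable (@len R G) (parts f).
Proof. by split => h e; apply/L2_onP; exact: h. Qed.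

Lemma eqL2P f g : eqL2 f g <->
  forall e b, ae_eq_on 0 (len e) (parts f e b) (parts g e b).
Proof.
split=> [fg e b|fg e].
  by apply: filterS (fg e) => x h xe; rewrite /parts h//= in_itv.
apply: filterS2 (fg e false) (fg e true) => x hr hi /=; rewrite in_itv/= => xe.
by apply: partP => -[]; [exact: hi|exact: hr].
Qed.

(** Multiplication by the imaginary unit, in real coordinates. *)
Definition rot (phi : @vfun R (edge G)) : @vfun R (edge G) :=
  fun e b x => if b then phi e false x else - phi e true x.

Lemma square_integrable_rot phi : square_integrable (@len R G) phi ->
  square_integrable (@len R G) (rot phi).
Proof. by move=> h e [|]; [exact: h|apply: sq_integrable_onN; exact: h]. Qed.

Lemma part_inner f g : L2 f -> L2 g -> forall b,
  part b (inner f g) =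
    if b then - vdot (@len R G) (rot (parts f)) (parts g)
    else vdot (@len R G) (parts f) (parts g).
Proof.
move=> /L2P f2 /L2P g2 b; rewrite part_sum.
under eq_bigr => e _ do rewrite (part_cintegral_mul_conj _ (f2 e) (g2 e)).
case: b; last by apply: eq_bigr => e _; rewrite big_bool addrC.
rewrite -sumrN; apply: eq_bigr => e _; rewrite big_bool/= opprD addrC; congr (_ + _).
  rewrite -rintN.
    by apply: eq_rint => x _; rewrite mulNr opprK.
  apply: sq_integrable_onM; last exact: (g2 e false).
  by apply: sq_integrable_onN; exact: (f2 e true).
Qed.

End GraphFunctions.

(** * Regularity for the adjoint of the minimal Laplacian *)

Section Regularity.
Context {R : realType} {G : metric_graph R}.
Implicit Types (f g h u du ddu w : gfun G).

Lemma minimal_laplacianI u du ddu :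
  (forall e, H2_rep (len e) (u e) (du e) (ddu e)) ->
  (forall e b, u e (endpoint e b) = 0) ->
  (forall v, normal_derivative du v = 0) ->
  minimal_laplacian G u (fun e x => - ddu e x).
Proof.
move=> h2 u0 du0; split.
- apply/L2P => e b; have [/H1_repP/(_ b)[_ hu] _] := h2 e.
  by apply: abs_cont_sq_integrable hu; exact/ltW/len_gt0.
- apply/L2P => e b; have [_ /H1_repP/(_ b)[_ hdu]] := h2 e.
  have [_ /H1_repP/(_ b)[ddu2 _]] := h2 e.
  by have := sq_integrable_onN ddu2; congr (sq_integrable_on _ _ _); apply/funext => x;
    rewrite /parts partN.
exists u, du, ddu; split => //.
- by apply/eqL2P => e b; exact: aeW.
- by apply/eqL2P => e b; exact: aeW.
- by move=> *; rewrite !u0.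
- by move=> v; split => // e b _; exact: u0.
Qed.

Lemma vdot_single (phi psi : @vfun R (edge G)) e0 b0 :
  (forall e b x, (e, b) != (e0, b0) -> phi e b x = 0) ->
  vdot (@len R G) phi psi = rint 0 (len e0) (fun x => phi e0 b0 x * psi e0 b0 x).
Proof.
move=> h; rewrite /vdot /vint (bigD1 e0)//= (bigD1 b0)//= !big1 ?addr0//.
- move=> e ee0; rewrite big1// => b _; rewrite (eq_rint (g := fun=> 0)) ?rint0// => x _.
  by rewrite h ?mul0r// xpair_eqE (negbTE ee0).
- move=> b bb0; rewrite (eq_rint (g := fun=> 0)) ?rint0// => x _.
  by rewrite h ?mul0r// xpair_eqE eqxx.
Qed.

(** Functions supported in one edge that vanish there with their derivative at both
    ends satisfy every vertex condition.  Real test functions suffice, because the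
    real and imaginary parts of the adjoint relation can be read separately. *)
Lemma adjoint_regularity f g : adjoint (minimal_laplacian G) f g ->
  forall e b, ae_affine_minus (len e) (parts f e b) (parts g e b).
Proof.
move=> [f2 g2 fg] e0 b0; have l0 := len_gt0 e0.
have /L2P f2' := f2; have /L2P g2' := g2.
apply: weak_second_derivative => // psi psi2 pl ppl.
pose at_e0 (p : R -> R) : @vfun R (edge G) :=
  fun e b x => if (e == e0) && ~~ b then p x else 0.
pose u := of_parts (at_e0 (primitive (primitive psi))).
pose du := of_parts (at_e0 (primitive psi)).
pose ddu := of_parts (at_e0 psi).
have l0' := ltW l0.
have P1 := abs_cont_primitive l0' (sq_integrable_onW psi2).
have P2 := abs_cont_primitive2 l0' (sq_integrable_onW psi2).
have at0 p e b : p 0 = 0 -> p (len e0) = 0 -> of_parts (at_e0 p) e (endpoint e b) = 0.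
  move=> p0 p1; rewrite /of_parts /at_e0 /= andbF andbT /endpoint.
  by case: eqP => // ->; case: b; rewrite ?p0 ?p1.
have Tu : minimal_laplacian G u (fun e x => - ddu e x).
  apply: (@minimal_laplacianI u du).
  - move=> e; have acI p dp : abs_cont 0 (len e0) p dp -> sq_integrable_on 0 (len e0) dp ->
        H1_rep (len e) (of_parts (at_e0 p) e) (of_parts (at_e0 dp) e).
      move=> hp dp2; apply/H1_repP => b.
      have eta q : (fun x => part b (of_parts (at_e0 q) e x)) = at_e0 q e b.
        by apply/funext => x; rewrite part_of_parts.
      rewrite !eta /at_e0; case: eqP => [->|_] /=.
        case: b {eta} => /=; last by [].
        by split; [exact: sq_integrable_on_cst|exact: abs_cont_cst].
      by split; [exact: sq_integrable_on_cst|exact: abs_cont_cst].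
    split; apply: acI => //.
    exact: abs_cont_sq_integrable P1.
  - by move=> e b; apply: at0 => //; exact: primitive0.
  - have du0 e b : du e (endpoint e b) = 0 by apply: at0 => //; exact: primitive0.
    by move=> v; apply: big1 => e _; apply: big1 => b _; rewrite du0 oppr0 if_same.
have [_ w2 _] := Tu; have [u2 _ _] := Tu.
have := fg _ _ Tu => /(congr1 (part b0)); rewrite !part_inner//.
have dd : parts (fun e x => - ddu e x) = at_e0 (fun x => - psi x).
  apply/funext => e; apply/funext => b; apply/funext => x.
  by rewrite /parts partN part_of_parts /at_e0; case: ifP => //; rewrite oppr0.
rewrite dd of_partsK.
have [psip _] : integrable_on 0 (len e0) (fun x => psi x * parts f e0 b0 x) /\ True.
  by split=> //; apply: sq_integrable_onM => //; exact: f2'.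
have sgl p b1 (k : gfun G) : vdot (@len R G) (if b1 then rot (at_e0 p) else at_e0 p) (parts k) =
    rint 0 (len e0) (fun x => p x * parts k e0 b1 x).
  rewrite (@vdot_single _ _ e0 b1).
    by apply: eq_rint => x _; case: b1; rewrite /rot /at_e0 eqxx.
  move=> e b x; rewrite xpair_eqE negb_and => /orP[|] h.
    by case: b1; case: b; rewrite /rot /at_e0 (negbTE h) /= ?oppr0.
  by move: h; case: b1; case: b; rewrite /rot /at_e0 ?andbF ?oppr0//= ?andbF ?oppr0.
have -> : rint 0 (len e0) (fun x => primitive (primitive psi) x * parts g e0 b0 x) =
  vdot (@len R G) (if b0 then rot (at_e0 (primitive (primitive psi)))
    else at_e0 (primitive (primitive psi))) (parts g).
  by rewrite sgl.
rewrite -rintN//.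
have -> : rint 0 (len e0) (fun x => - (psi x * parts f e0 b0 x)) =
   vdot (@len R G) (if b0 then rot (at_e0 (fun x => - psi x))
     else at_e0 (fun x => - psi x)) (parts f).
  by rewrite sgl; apply: eq_rint => x _; rewrite mulNr.
by case: (b0) => // /oppr_inj.
Qed.

End Regularity.

(** * Eigenfunctions of the Krein Laplacian *)

Section Continuity.
Context {R : realType}.
Local Notation mu := (@lebesgue_measure R).
Implicit Types (l x : R) (k u du : R -> R).

Lemma ae_on_witness (a c : R) (P : R -> Prop) : a < c ->
  {ae mu, forall x, a < x < c -> P x} -> exists2 x, a < x < c & P x.
Proof.
move=> ac h; apply: contrapT => hn.
have : mu.-negligible `]a, c[%classic.
  apply: negligibleS h => x /=; rewrite in_itv/= => xac Px.
  by apply: hn; exists x => //; exact: Px.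
move=> neg; have := @measure_negligible _ _ _ mu _ (measurable_itv `]a, c[) neg.
rewrite /= lebesgue_measure_itv/= lte_fin ac -EFinB => -[] /eqP.
by rewrite subr_eq0 gt_eqF.
Qed.

Lemma abs_cont_ae_eq0 l k dk : 0 < l -> abs_cont 0 l k dk ->
  ae_eq_on 0 l k (fun=> 0) -> forall x, 0 <= x <= l -> k x = 0.
Proof.
move=> l0 hk k0 x xl; apply/eqP/negPn/negP => kx.
have /subspace_continuousP/(_ x) := abs_cont_continuous (ltW l0) hk.
rewrite /= in_itv/= => /(_ xl)/cvgr_neq0/(_ kx).
rewrite near_withinE => /nbhs_ballP[d /= d0 kd].
have /andP[x0 xl'] := xl.
pose a := Num.max 0 (x - d); pose c := Num.min l (x + d).
have ac : a < c.
  by rewrite lt_min !gt_max; apply/andP; split; apply/andP; split => //; lra.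
have kac : {ae mu, forall y, a < y < c -> k y = 0}.
  apply: filterS k0 => y + /andP[]; rewrite gt_max lt_min => + /andP[y0 _] /andP[yl _].
  by apply; rewrite y0.
have [y /andP[]] := ae_on_witness ac kac.
rewrite gt_max lt_min => /andP[y0 yd1] /andP[yl yd2] ky.
have : k y != 0; last by rewrite ky eqxx.
apply: kd; last by rewrite /= in_itv/= !ltW.
by rewrite /ball/= ltr_norml; apply/andP; split; lra.
Qed.

Lemma abs_cont_ae_eq l u v du dv : 0 < l -> abs_cont 0 l u du -> abs_cont 0 l v dv ->
  ae_eq_on 0 l u v -> forall x, 0 <= x <= l -> u x = v x.
Proof.
move=> l0 hu hv uv x xl; apply/eqP; rewrite -subr_eq0; apply/eqP.
apply: (abs_cont_ae_eq0 l0 (abs_contB hu hv) _ xl).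
by apply: filterS uv => y h yl; rewrite h// subrr.
Qed.

(** The difference k of du and dv is orthogonal to itself: integrate by parts
    against its primitive, which is 0. *)
Lemma abs_cont_unique l u du dv ddu ddv : 0 < l ->
  abs_cont 0 l u du -> abs_cont 0 l u dv ->
  abs_cont 0 l du ddu -> abs_cont 0 l dv ddv ->
  forall x, 0 <= x <= l -> du x = dv x.
Proof.
move=> l0 hu1 hu2 hdu hdv; have l0' := ltW l0.
have hk := abs_contB hdu hdv; have hK := abs_contB hu1 hu2.
have := abs_cont_by_parts l0' hK hk.
rewrite !subrr !mul0r subrr.
rewrite (eq_rint (g := fun x => (du x - dv x) ^+ 2)); last by move=> x _; ring.
move=> k0.
have := rint_sqr_eq0 (abs_cont_sq_integrable l0' hk).
rewrite k0 lexx => /(_ isT) /(abs_cont_ae_eq0 l0 hk) h x /h /eqP.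
by rewrite subr_eq0 => /eqP.
Qed.

End Continuity.

Section KreinData.
Context {R : realType} {G : metric_graph R}.
Local Notation T := (minimal_laplacian G).
Implicit Types (f U dU : @vfun R (edge G)) (F : gfun G).

(** What is needed of an eigenfunction F: the representative f, its component U in
    the domain of the minimal Laplacian with - U'' = m f, and f - U in the kernel of
    the adjoint. *)
Definition krein_data m F f U dU :=
  [/\ forall e b, ae_eq_on 0 (len e) (parts F e b) (f e b),
      forall e b, [/\ abs_cont 0 (len e) (U e b) (dU e b),
        abs_cont 0 (len e) (dU e b) (fun x => - m * f e b x),
        U e b 0 = 0 & U e b (len e) = 0],
      square_integrable (@len R G) f,
      forall v, normal_derivative (of_parts dU) v = 0 &
      ker (adjoint T) (of_parts (fun e b x => f e b x - U e b x))].

Lemma ae_affine_minus0 (l : R) (p : R -> R) : 0 <= l ->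
  ae_affine_minus l p (fun=> 0) -> exists a b, ae_eq_on 0 l p (fun x => a + b * x).
Proof.
move=> l0 [a [b h]]; exists a, b; apply: filterS h => x + xl => /(_ xl) ->.
have p0 : primitive (fun=> 0) = (fun=> 0 : R) by apply/funext => y; exact: rint0.
by rewrite p0 p0 subr0.
Qed.

Lemma adjoint_ae_eq (F f g : gfun G) : eqL2 F f -> L2 f -> adjoint T F g -> adjoint T f g.
Proof.
move=> Ff f2 [F2 g2 h]; split => // u w Tuw; rewrite -(h u w Tuw).
have [_ w2 _] := Tuw.
apply: partP => b; rewrite !part_inner//.
have E phi : square_integrable (@len R G) phi ->
    vdot (@len R G) phi (parts f) = vdot (@len R G) phi (parts F).
  move=> p2; apply: eq_bigr => e _; apply: eq_bigr => b' _.
  have /L2P f2' := f2; have /L2P F2' := F2.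
  apply: rint_ae_eq.
  - apply: measurable_funM; [by have [] := p2 e b'|by have [] := f2' e b'].
  - apply: measurable_funM; [by have [] := p2 e b'|by have [] := F2' e b'].
  by have /eqL2P/(_ e b') := Ff; apply: filterS => x h' xe; rewrite h'.
have /L2P w2' := w2.
by case: b; rewrite E//; exact: square_integrable_rot.
Qed.

(** Write F = u + h.  By regularity h is affine and F is an affine function minus a
    second primitive of m F, so u is such a function as well; comparing it with the
    given representative of u identifies the derivative of the latter. *)
Lemma krein_eigenvector_data m F : eigenvector (krein_laplacian G) m F ->
  exists f U dU, krein_data m F f U dU.
Proof.
move=> [adF [u [h [[g [u2 g2 [U [dU [ddU [H2 uU gU contU bc]]]]]] kerh FE]]]].
have lg0 := @len_gt0 R G.
have [F2 _ _] := adF; have /L2P F2' := F2.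
have [h2 _ _] := kerh; have /L2P h2' := h2.
have haff e b : exists ab : R * R, ae_eq_on 0 (len e) (parts h e b) (fun x => ab.1 + ab.2 * x).
  have := adjoint_regularity kerh e b.
  rewrite (_ : parts (fun _ _ => 0) e b = fun=> 0); last first.
    by apply/funext => x; rewrite /parts part0.
  by move/(ae_affine_minus0 (ltW (lg0 e))) => [a1 [a2 ?]]; exists (a1, a2).
have [AB HAB] := choice (fun eb => haff eb.1 eb.2).
pose H : @vfun R (edge G) := fun e b x => (AB (e, b)).1 + (AB (e, b)).2 * x.
have acH e b : abs_cont 0 (len e) (H e b) (fun=> (AB (e, b)).2).
  have := abs_contD (abs_cont_cst 0 (len e) (AB (e, b)).1)
    (abs_contZ (AB (e, b)).2 (abs_cont_id (ltW (lg0 e)))).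
  by apply: eq_abs_cont => //; [exact: ltW|move=> x _; rewrite add0r mulr1].
have acU e b : abs_cont 0 (len e) (parts U e b) (parts dU e b).
  by have [/H1_repP/(_ b)[]] := H2 e.
have acdU e b : abs_cont 0 (len e) (parts dU e b) (parts ddU e b).
  by have [_ /H1_repP/(_ b)[]] := H2 e.
pose f : @vfun R (edge G) := fun e b x => parts U e b x + H e b x.
have acf e b : abs_cont 0 (len e) (f e b) (fun x => parts dU e b x + (AB (e, b)).2).
  exact: abs_contD.
have Ff e b : ae_eq_on 0 (len e) (parts F e b) (f e b).
  have /eqL2P/(_ e b) h1 := FE; have /eqL2P/(_ e b) h2'' := uU.
  apply: filterS3 h1 h2'' (HAB (e, b)) => x /= k1 k2 k3 xe.
  by rewrite k1// /parts partD -/(parts u e b x) -/(parts h e b x) k2// k3.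
have f2 : square_integrable (@len R G) f.
  by move=> e b; exact: abs_cont_sq_integrable (ltW (lg0 e)) (acf e b).
exists f, (parts U), (parts dU); split => //.
- move=> e b; have l0 := lg0 e; have l0' := ltW l0.
  have Uend b' : parts U e b (endpoint e b') = 0.
    have [/(_ e b' erefl) + _] := bc (bd e b').
    by rewrite /parts => ->; rewrite part0.
  split; [exact: acU| |exact: (Uend false)|exact: (Uend true)].
  have Fi := sq_integrable_onW (F2' e b).
  have mFi : integrable_on 0 (len e) (fun x => m * parts F e b x) by exact: integrable_onZ.
  have [a [c]] := adjoint_regularity adF e b.
  have -> : parts (fun e x => m%:C * F e x) e b = fun x => m * parts F e b x.
    by apply/funext => x; rewrite /parts partZ.
  move=> Fac.
  have I1 := abs_cont_primitive l0' mFi; have I2 := abs_cont_primitive2 l0' mFi.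
  (* V is the second expression of u, as the solution for F minus h. *)
  pose V x := a + c * x - primitive (primitive (fun x => m * parts F e b x)) x - H e b x.
  pose dV x := c - primitive (fun x => m * parts F e b x) x - (AB (e, b)).2.
  have acaff : abs_cont 0 (len e) (fun x => a + c * x) (fun=> c).
    have := abs_contD (abs_cont_cst 0 (len e) a) (abs_contZ c (abs_cont_id l0')).
    by apply: eq_abs_cont => // x _; rewrite add0r mulr1.
  have acV : abs_cont 0 (len e) V dV.
    by apply: abs_contB (acH e b); exact: abs_contB acaff I2.
  have acdV : abs_cont 0 (len e) dV (fun x => - m * parts F e b x).
    have := abs_contB (abs_contB (abs_cont_cst 0 (len e) c) I1)
      (abs_cont_cst 0 (len e) (AB (e, b)).2).
    by apply: eq_abs_cont => // x _; rewrite subr0 sub0r mulNr.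
  have UV : forall x, 0 <= x <= len e -> parts U e b x = V x.
    apply: (abs_cont_ae_eq l0 (acU e b) acV).
    apply: filterS2 Fac (Ff e b) => x k1 k2 xe.
    by rewrite /V -k1// k2// /f addrK.
  have dUV : forall x, 0 <= x <= len e -> parts dU e b x = dV x.
    apply: (abs_cont_unique l0 (acU e b) _ (acdU e b) acdV).
    by apply: eq_abs_cont acV => // x xl; rewrite UV.
  have fi : integrable_on 0 (len e) (f e b) by exact: sq_integrable_onW.
  split; first exact: integrable_onZ.
  move=> x xl; have /andP[x0 xle] := xl.
  rewrite !dUV ?lexx//; have [_ ->//] := acdV; congr (_ + _).
  apply: rint_ae_eq.
  + apply: integrable_on_measurable; apply: integrable_on_sub (integrable_onZ _ Fi) => //.
  + apply: integrable_on_measurable; apply: integrable_on_sub (integrable_onZ _ fi) => //.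
  apply: filterS (Ff e b) => y k /andP[y0 yx]; rewrite k// y0/=.
  exact: lt_le_trans xle.
- move=> v; have [_ <-] := bc v; apply: eq_bigr => e _; apply: eq_bigr => b _.
  have E e' x : of_parts (parts dU) e' x = dU e' x.
    by apply: partP => b'; rewrite part_of_parts.
  by rewrite E.
apply: adjoint_ae_eq kerh.
  apply/eqL2P => e b; apply: filterS (HAB (e, b)) => x k xe.
  by rewrite k// of_partsK /f [RHS]addrAC subrr add0r.
apply/L2P; rewrite of_partsK => e b; apply: sq_integrable_onB; first exact: f2.
exact: abs_cont_sq_integrable (ltW (lg0 e)) (acU e b).
Qed.

End KreinData.

Section Rotation.
Context {R : realType} {G : metric_graph R}.
Implicit Types (phi psi : @vfun R (edge G)).

Lemma vdot_rotl phi psi : square_integrable (@len R G) phi ->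
  square_integrable (@len R G) psi ->
  vdot (@len R G) phi (rot psi) = - vdot (@len R G) (rot phi) psi.
Proof.
move=> h1 h2; rewrite -sumrN; apply: eq_bigr => e _.
rewrite !big_bool/= opprD addrC; congr (_ + _); rewrite -rintN.
- by apply: eq_rint => x _; rewrite mulrN.
- exact: sq_integrable_onM (h1 e false) (h2 e true).
- by apply: eq_rint => x _; rewrite mulNr opprK.
- by apply: sq_integrable_onM (h2 e false); exact: sq_integrable_onN (h1 e true).
Qed.

Lemma vdot_rot phi psi : vdot (@len R G) (rot phi) (rot psi) = vdot (@len R G) phi psi.
Proof.
apply: eq_bigr => e _; rewrite !big_bool/= addrC; congr (_ + _).
by apply: eq_rint => x _; rewrite mulrNN.
Qed.

End Rotation.

Section KreinBound.
Context {R : realType} {G : metric_graph R}.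
Local Notation dot := (vdot (@len R G)).
Implicit Types (f U dU : @vfun R (edge G)) (F : gfun G).

(** S U = m f is in the range of S, hence orthogonal to the kernel of the adjoint.
    The two conclusions are the real and imaginary parts of this. *)
Lemma krein_data_orthogonal m F f U dU m' F' f' U' dU' : 0 < m ->
  krein_data m F f U dU -> krein_data m' F' f' U' dU' ->
  dot f (fun e b x => f' e b x - U' e b x) = 0 /\
  dot (rot f) (fun e b x => f' e b x - U' e b x) = 0.
Proof.
move=> m0 [_ hU f2 nd _] [_ hU' f'2 _ [h2 z2 hker]].
pose ddU : gfun G := of_parts (fun e b x => - m * f e b x).
have Tu : minimal_laplacian G (of_parts U) (fun e x => - ddU e x).
  apply: (@minimal_laplacianI _ _ (of_parts U) (of_parts dU)) => //.
  - move=> e; split; apply/H1_repP => b; under eq_fun do rewrite part_of_parts.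
      split; last by under eq_fun do rewrite part_of_parts; case: (hU e b).
      have [_ h _ _] := hU e b; exact: abs_cont_sq_integrable (ltW (len_gt0 e)) h.
    split; last by under eq_fun do rewrite part_of_parts; case: (hU e b).
    by apply: sq_integrable_onZ; exact: f2.
  - move=> e b; apply: partP => b'; rewrite part_of_parts part0.
    by have [_ _ h0 h1] := hU e b'; case: b.
have hin := hker _ _ Tu.
have [u2 w2 _] := Tu.
have part_in b := congr1 (part b) hin.
have wE : parts (fun e x => - ddU e x) = fun e b x => m * f e b x.
  apply/funext => e; apply/funext => b; apply/funext => x.
  by rewrite /parts partN part_of_parts mulNr opprK.
have zE : parts (fun (_ : edge G) _ => 0) = fun _ _ _ => 0 :> R.
  by apply/funext => e; apply/funext => b; apply/funext => x; rewrite /parts part0.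
have dot0 phi : dot phi (fun _ _ _ => 0) = 0.
  rewrite /vdot /vint big1// => e _; rewrite big1// => b _.
  by rewrite (eq_rint (g := fun=> 0)) ?rint0// => x _; rewrite mulr0.
have /L2P h2' := h2; rewrite of_partsK in h2'.
have mn0 : m != 0 by rewrite gt_eqF.
split.
  have := part_in false; rewrite !part_inner// wE zE dot0 of_partsK vdotZl//.
  by move/eqP; rewrite mulf_eq0 (negbTE mn0) => /eqP.
have := part_in true; rewrite !part_inner// wE zE dot0 of_partsK oppr0.
have -> : rot (fun e b x => m * f e b x) = fun e b x => m * rot f e b x.
  apply/funext => e; apply/funext => b; apply/funext => x.
  by rewrite /rot; case: b => //; rewrite mulrN.
rewrite vdotZl//; last exact: square_integrable_rot.
by move/eqP; rewrite oppr_eq0 mulf_eq0 (negbTE mn0) => /eqP.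
Qed.

(** The integral of m f = - U'' over all edges is minus the sum over all vertices of
    the normal derivatives of U. *)
Lemma krein_data_mean0 m F f U dU b : 0 < m -> krein_data m F f U dU ->
  \sum_(e : edge G) rint 0 (len e) (f e b) = 0.
Proof.
move=> m0 [_ hU f2 nd _].
have : \sum_(v : vertex G) part b (normal_derivative (of_parts dU) v) = 0.
  by rewrite big1// => v _; rewrite nd part0.
rewrite /normal_derivative; under eq_bigr => v _ do rewrite part_sum.
rewrite exchange_big /=.
have E e : \sum_(v : vertex G) part b (\sum_(b' : bool | bd e b' == v)
    (if b' then of_parts dU e (endpoint e b') else - of_parts dU e (endpoint e b'))) =
    - m * rint 0 (len e) (f e b).
  under eq_bigr => v _ do rewrite part_sum big_mkcond/=.
  rewrite exchange_big/= big_bool/= -!big_mkcond/=.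
  under eq_bigl do rewrite eq_sym.
  under [X in _ + X]eq_bigl do rewrite eq_sym.
  rewrite !big_pred1_eq partN !part_of_parts /endpoint.
  have [_ [_ edU] _ _] := hU e b.
  rewrite (edU (len e)) ?lexx ?ltW ?len_gt0//.
  by rewrite addrC addKr rintZ//; exact: sq_integrable_onW (f2 e b).
under eq_bigr => e _ do rewrite E.
move/eqP; rewrite -mulr_sumr mulf_eq0 oppr_eq0 gt_eqF//= => /eqP.
exact.
Qed.

(** Over the reals, each complex eigenfunction contributes itself and its product
    with the imaginary unit. *)
Lemma krein_bound (I : finType) (F : I -> gfun G) (lam : I -> R) (k : nat) (t : R) :
  (forall i, eigenvector (krein_laplacian G) (lam i) (F i)) ->
  (forall i, 0 < lam i) -> (forall i, lam i <= t) ->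
  (forall (z : I -> R[i]) m, (forall i, z i != 0 -> lam i = m) ->
     eqL2 (fun e x => \sum_i z i * F i e x) (fun _ _ => 0) -> forall i, z i = 0) ->
  (0 < k)%N -> (k.*2.-1 <= #|I|)%N ->
  (pi * k.*2%:R / total_length G) ^+ 2 <= t.
Proof.
move=> eigF lam0 lamt free k0 kI.
have [D HD] := choice (fun i => krein_eigenvector_data (eigF i)).
have [D2 {}HD] := choice HD; have [D3 {}HD] := choice HD.
pose rt (s : bool) (phi : @vfun R (edge G)) := if s then rot phi else phi.
pose f (j : I * bool) := rt j.2 (D j.1).
pose U (j : I * bool) := rt j.2 (D2 j.1).
pose dU (j : I * bool) := rt j.2 (D3 j.1).
have D_2 i : square_integrable (@len R G) (D i) by case: (HD i).
have l0 e : 0 <= @len R G e by exact/ltW/len_gt0.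
have acN l u du : abs_cont 0 l u du -> abs_cont 0 l (fun x : R => - u x) (fun x : R => - du x).
  by move=> /(abs_contZ (-1)); congr (abs_cont _ _ _ _); apply/funext => x; rewrite mulN1r.
apply: (@rayleigh_loop_bound R (edge G) (@len R G) (@len_gt0 R G) _ f U dU (fun j => lam j.1)) => //.
- move=> [i [|]]; rewrite /f /rt/=; [exact: square_integrable_rot|exact: D_2].
- move=> [i [|]] e b; rewrite /U /dU /rt/= ; have [_ hU _ _ _] := HD i; last by case: (hU e b).
  by case: b; [case: (hU e false)|apply: acN; case: (hU e true)].
- move=> [i [|]] e b; rewrite /f /dU /rt/= ; have [_ hU _ _ _] := HD i; last by case: (hU e b).
  case: b; first by case: (hU e false).
  have [_ h _ _] := hU e true; have := acN _ _ _ h.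
  by apply: eq_abs_cont => // x _; rewrite /rot mulrN.
- move=> [i [|]] e b; rewrite /U /rt/= ; have [_ hU _ _ _] := HD i; last by case: (hU e b).
  case: b; first by case: (hU e false).
  by rewrite /rot; have [_ _ -> _] := hU e true; rewrite oppr0.
- move=> [i [|]] e b; rewrite /U /rt/= ; have [_ hU _ _ _] := HD i; last by case: (hU e b).
  case: b; first by case: (hU e false).
  by rewrite /rot; have [_ _ _ ->] := hU e true; rewrite oppr0.
- move=> [i s] [j s']; have [h1 h2'] := krein_data_orthogonal (lam0 i) (HD i) (HD j).
  have U2 : square_integrable (@len R G) (D2 j).
    by have [_ hU _ _ _] := HD j => e b; have [h _ _ _] := hU e b; exact: abs_cont_sq_integrable h.
  have h2 : square_integrable (@len R G) (fun e b x => D j e b x - D2 j e b x).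
    by move=> e b; apply: sq_integrable_onB; [exact: D_2|exact: U2].
  rewrite /f /U /rt /=.
  have rotB : (fun e b x => rot (D j) e b x - rot (D2 j) e b x) =
      rot (fun e b x => D j e b x - D2 j e b x).
    apply/funext => e; apply/funext => b; apply/funext => x.
    by rewrite /rot; case: b => //; rewrite opprB addrC opprK.
  case: s'; rewrite ?rotB; case: s => //.
    by rewrite vdot_rot.
  by rewrite vdot_rotl// h2' oppr0.
- move=> [i s] b; rewrite /f /rt/=; case: s; last exact: krein_data_mean0 (lam0 i) (HD i).
  rewrite /rot; case: b; first exact: krein_data_mean0 (lam0 i) (HD i).
  under eq_bigr => e _ do (rewrite rintN; last exact: sq_integrable_onW (D_2 i e true)).
  by rewrite sumrN (krein_data_mean0 _ (lam0 i) (HD i)) oppr0.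
- move=> c m cm c0; pose z i := c (i, false) +i* c (i, true).
  have z0 : forall i, z i = 0.
    apply: (free z m).
      move=> i zi; apply/eqP/negPn/negP => lm.
      move: zi; have cis s : c (i, s) = 0.
        by apply/eqP/negPn/negP => /cm /eqP; rewrite (negbTE lm).
      by rewrite /z !cis eqxx.
    apply/eqL2P => e b; have all_ae : {ae lebesgue_measure, forall x : R, forall i,
        forall b, 0 < x < len e -> parts (F i) e b x = D i e b x}.
      apply: filter_forall => i.
      have [hF _ _ _ _] := HD i.
      by apply: filterS2 (hF e false) (hF e true) => x h1 h2 [] xe; [exact: h2|exact: h1].
    apply: filterS2 all_ae (c0 e b) => x h1 h2 xe.
    rewrite /parts part0 part_sum; apply: etrans (h2 xe); rewrite /comb.
    rewrite [RHS](eq_bigr (fun p => c (p.1, p.2) * f (p.1, p.2) e b x)); last by case.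
    rewrite -(pair_bigA _ (fun i s => c (i, s) * f (i, s) e b x))/=.
    apply: eq_bigr => i _; rewrite big_bool /f /rt /= /rot.
    have := h1 i false xe; have := h1 i true xe; rewrite /parts.
    case: (F i e x) => p q /= -> ->.
    by case: b {c0 h2} => /=; ring.
  move=> [i s]; have := congr1 (part s) (z0 i); rewrite part0.
  by case: s.
- exact: edge_nonempty.
- by rewrite card_prod card_bool; lia.
Qed.

End KreinBound.

(** * From eigenvalue counts to finite families *)

Section Counting.
Import finmap.
Context {R : realType} {G : metric_graph R} (T : operator G).

Definition has_independent_eigenvectors (m : R) (n : nat) :=
  exists F : 'I_n -> gfun G,
    (forall i, eigenvector T m (F i)) /\ linearly_independent F.

Local Notation S := has_independent_eigenvectors.

Lemma has_independent_eigenvectors0 m : S m 0.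
Proof. by exists (fun=> fun _ _ => 0); split => [[]|c _ []]. Qed.

Lemma multiplicity_ubound m n : S m n -> (n%:R%:E <= multiplicity T m)%E.
Proof. by move=> Smn; apply: ereal_sup_ubound; exists n. Qed.

Lemma multiplicity_ge0 m : (0 <= multiplicity T m)%E.
Proof. exact: multiplicity_ubound (has_independent_eigenvectors0 m). Qed.

Lemma multiplicity_le m k : (forall n, S m n -> (n <= k)%N) ->
  (multiplicity T m <= k%:R%:E)%E.
Proof.
by move=> h; apply: ge_ereal_sup => _ [n /h nk <-]; rewrite lee_fin ler_nat.
Qed.

(** A finite supremum of natural numbers is attained. *)
Lemma multiplicity_fin m k : (multiplicity T m <= k%:R%:E)%E ->
  exists2 n, multiplicity T m = n%:R%:E & S m n.
Proof.
elim: k => [m0|k IH mk].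
  exists 0%N; last exact: has_independent_eigenvectors0.
  by apply/le_anti; rewrite m0 multiplicity_ge0.
have [Sk|nSk] := pselect (S m k.+1).
  by exists k.+1 => //; apply/le_anti; rewrite mk multiplicity_ubound.
apply/IH/multiplicity_le => n Sn.
have := le_trans (multiplicity_ubound Sn) mk.
rewrite lee_fin ler_nat leq_eqVlt ltnS => /predU1P[nk|//].
by move: Sn; rewrite nk.
Qed.

(** Treat the eigenvalues one by one: a multiplicity at most j is attained and is
    subtracted from j, a larger one settles the matter alone. *)
Lemma sum_multiplicity_gt (s : seq R) (j : nat) : uniq s ->
  (j%:R%:E < \sum_(m <- s) multiplicity T m)%E ->
  exists2 n : R -> nat, (j < \sum_(m <- s) n m)%N & forall m, S m (n m).
Proof.
elim: s j => [|m s IH] j /=; first by rewrite big_nil lte_fin ltrn0.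
move=> /andP[ms us]; rewrite big_cons => jlt.
have [mj|jm] := leP (multiplicity T m) j%:R%:E.
  have [n mn Sn] := multiplicity_fin mj.
  move: mj jlt; rewrite mn lee_fin ler_nat => nj.
  rewrite -lteBlDl// -EFinB -natrB// => /(IH _ us)[n' jn' Sn'].
  exists (fun x => if x == m then n else n' x).
    rewrite big_cons eqxx -ltn_subLR// (leq_trans jn')//.
    rewrite leq_eqVlt; apply/orP; left; apply/eqP.
    apply: eq_big_seq => x xs; case: eqP => // xm.
    by move: ms; rewrite -xm xs.
  by move=> x; case: eqP => [->|].
have [_ [n Sn <-]] := ereal_sup_gt jm; rewrite lte_fin ltr_nat => jn.
exists (fun x => if x == m then n else 0%N).
  by rewrite big_cons eqxx ltn_addr.
by move=> x; case: eqP => [->//|_]; exact: has_independent_eigenvectors0.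
Qed.

(** The sum defining the count is a supremum over finite sets of eigenvalues, and it
    need not be attained; but a finite partial sum exceeds j, which is enough for
    j.+1 eigenvectors. *)
Lemma eigenvalue_count_family (P : set R) (t : R) (j : nat) :
  (j.+1%:R%:E <= eigenvalue_count T P t)%E ->
  exists (I : finType) (F : I -> gfun G) (lam : I -> R),
    [/\ (j < #|I|)%N, forall i, eigenvector T (lam i) (F i),
        forall i, P (lam i) /\ lam i <= t &
        forall (z : I -> R[i]) m, (forall i, z i != 0 -> lam i = m) ->
          eqL2 (fun e x => \sum_i z i * F i e x) (fun _ _ => 0) ->
          forall i, z i = 0].
Proof.
move=> jt; have : (j%:R%:E < eigenvalue_count T P t)%E.
  by apply: lt_le_trans jt; rewrite lte_fin ltr_nat.
move=> /ereal_sup_gt[_ [A [finA AP] <-]].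
rewrite fsbig_finite//= => /(sum_multiplicity_gt (fset_uniq _))[n jn Sn].
set s : seq R := fset_set A in jn.
have us : uniq s by exact: fset_uniq.
have sP m : m \in s -> P m /\ m <= t.
  move=> ms; have : m \in fset_set A by [].
  by rewrite in_fset_set// => /set_mem/AP.
pose ev (k : 'I_(size s)) := s`_k.
have evinj : injective ev.
  by move=> k k' /eqP; rewrite nth_uniq// => /eqP/val_inj.
pose FF (k : 'I_(size s)) := sval (cid (Sn (ev k))).
have FFP k : (forall i, eigenvector T (ev k) (FF k i)) /\ linearly_independent (FF k).
  exact: svalP (cid (Sn (ev k))).
exists {k : 'I_(size s) & 'I_(n (ev k))}, (fun p => FF (tag p) (tagged p)), (fun p => ev (tag p)).
split.
- rewrite card_tagged sumnE big_map big_enum/=.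
  under eq_bigr do rewrite card_ord.
  by rewrite (big_nth 0) big_mkord in jn.
- by move=> p; case: (FFP (tag p)).
- by move=> p; apply/sP/mem_nth.
- move=> z m zm zF0 [k l].
  have [km|km] := eqVneq (ev k) m; last first.
    by apply/eqP/negPn/negP => /zm /eqP; rewrite /= (negbTE km).
  have [_ indep] := FFP k.
  apply: (indep (fun l' => z (Tagged (fun k => 'I_(n (ev k))) l'))).
  move=> e; apply: filterS (zF0 e) => x h xe; rewrite -[RHS](h xe).
  have -> : \sum_p z p * FF (tag p) (tagged p) e x =
      \sum_k' \sum_(l' : 'I_(n (ev k'))) z (Tagged (fun k => 'I_(n (ev k))) l') * FF k' l' e x.
    by rewrite sig_big_dep; apply: eq_bigr => -[].
  rewrite (bigD1 k)//= [X in _ = _ + X]big1 ?addr0// => k' kk'.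
  rewrite big1// => l' _.
  suff -> : z (Tagged (fun k => 'I_(n (ev k))) l') = 0 by rewrite mul0r.
  apply/eqP/negPn/negP => /zm /=; rewrite -km => /evinj kk.
  by move: kk'; rewrite kk eqxx.
Qed.

End Counting.

(** * The spectrum of the loop *)

Section LoopSpectrum.
Context {R : realType} (La : metric_graph R).
Hypothesis loopLa : is_loop La.
Local Notation T := (standard_laplacian La).
Local Notation L := (total_length La).

Lemma loop_edge : exists e0 : edge La, forall e, e = e0.
Proof.
have [_ /eqP/fintype1P[e0 he0]] := loopLa; by exists e0.
Qed.

Lemma loop_vertex : exists v0 : vertex La, forall v, v = v0.
Proof.
have [/eqP/fintype1P[v0 hv0] _] := loopLa; by exists v0.
Qed.

Lemma loop_len e : @len R La e = L.
Proof.
have [e0 he0] := loop_edge; rewrite (he0 e) /total_length (bigD1 e0)//= big1 ?addr0//.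
by move=> e' /eqP; rewrite (he0 e').
Qed.

Lemma loop_length_gt0 : 0 < L.
Proof. by have [e0 _] := loop_edge; rewrite -(loop_len e0) len_gt0. Qed.

Lemma loop_normal_derivative (du : gfun La) e v :
  normal_derivative du v = du e L - du e 0.
Proof.
have [e0 he0] := loop_edge; have [v0 hv0] := loop_vertex.
rewrite /normal_derivative (bigD1 e0)//= [X in _ + X]big1 ?addr0; last first.
  by move=> e' /eqP; rewrite (he0 e').
rewrite (he0 e) big_mkcond big_bool/= !(hv0 (bd _ _)) (hv0 v) eqxx.
by rewrite /endpoint loop_len.
Qed.

Lemma loop_eigenvector (m : R) (u du : R -> R) :
  abs_cont 0 L u du -> abs_cont 0 L du (fun x => - m * u x) ->
  u L = u 0 -> du L = du 0 ->
  eigenvector T m (fun e x => (u x)%:C).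
Proof.
move=> hu hdu uL duL; have L0 := ltW loop_length_gt0.
have u2 := abs_cont_sq_integrable L0 hu; have du2 := abs_cont_sq_integrable L0 hdu.
pose C (p : R -> R) : gfun La := fun e x => (p x)%:C.
have partC p b e x : part b (C p e x) = if b then 0 else p x by case: b.
have C2 p : sq_integrable_on 0 L p -> forall e b,
    sq_integrable_on 0 (len e) (fun x => part b (C p e x)).
  move=> p2 e b; under eq_fun do rewrite partC; rewrite loop_len.
  by case: b => //; exact: sq_integrable_on_cst.
have CH p dp : sq_integrable_on 0 L dp -> abs_cont 0 L p dp -> forall e,
    H1_rep (len e) (C p e) (C dp e).
  move=> dp2 hp e; apply/H1_repP => b; split; first exact: C2.
  under eq_fun do rewrite partC; under [X in abs_cont _ _ _ X]eq_fun do rewrite partC.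
  by rewrite loop_len; case: b => //; exact: abs_cont_cst.
have mu2 : sq_integrable_on 0 L (fun x => - m * u x) by exact: sq_integrable_onZ.
split.
- by apply/L2P => e b; exact: C2.
- apply/L2P => e b.
  have := C2 _ (sq_integrable_onZ m u2) e b.
  congr (sq_integrable_on _ _ _); apply/funext => x.
  by rewrite /parts partZ !partC; case: b; rewrite ?mulr0.
exists (C u), (C du), (C (fun x => - m * u x)); split.
- by move=> e; split; exact: CH.
- by apply/eqL2P => e b; exact: aeW.
- apply/eqL2P => e b; apply: aeW => x _.
  by rewrite /parts partZ partN !partC; case: b; rewrite ?mulr0 ?oppr0// mulNr opprK.
- move=> e b e' b' _; rewrite /C /endpoint !loop_len.
  by case: b; case: b'; rewrite ?uL.
- move=> v; have [e0 _] := loop_edge.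
  by rewrite (loop_normal_derivative _ e0) /C duL subrr.
Qed.

Lemma loop_eigenvectorE (m : R) (F : gfun La) : eigenvector T m F ->
  exists u du : bool -> R -> R, forall b,
    [/\ abs_cont 0 L (u b) (du b), abs_cont 0 L (du b) (fun x => - m * u b x),
        u b L = u b 0, du b L = du b 0 &
        forall e, ae_eq_on 0 L (parts F e b) (u b)].
Proof.
have [e0 he0] := loop_edge; have L0 := ltW loop_length_gt0.
move=> [F2 _ [u [du [ddu [H2 Fu Fdd cont bc]]]]].
exists (parts u e0), (parts du e0) => b.
have lL := loop_len e0.
have [/H1_repP/(_ b)[_ hu] /H1_repP/(_ b)[_ hdu]] := H2 e0.
rewrite -/(parts u e0 b) -/(parts du e0 b) -/(parts ddu e0 b) lL in hu hdu.
have Fae : ae_eq_on 0 L (parts F e0 b) (parts u e0 b).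
  by have /eqL2P/(_ e0 b) := Fu; rewrite lL.
split=> //.
- split; first by apply: integrable_onZ; exact: abs_cont_integrable hu.
  move=> x xl; have [ddi ->//] := hdu; congr (_ + _).
  have /andP[x0 xL] := xl.
  apply: rint_ae_eq.
  + by apply: integrable_on_measurable; exact: integrable_on_sub ddi.
  + apply: integrable_on_measurable; apply: integrable_onZ.
    by apply: integrable_on_sub (abs_cont_integrable L0 hu).
  have /eqL2P/(_ e0 b) := Fdd; rewrite lL => h.
  apply: filterS2 h Fae => y h1 h2 /andP[y0 yx].
  have yL : 0 < y < L by rewrite y0 (lt_le_trans yx).
  have := h1 yL; rewrite /parts partZ partN -/(parts F e0 b y) h2// => h3.
  by rewrite mulNr /parts in h3 *; rewrite h3 opprK.
- have [v0 hv0] := loop_vertex.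
  have := cont e0 true e0 false; rewrite !(hv0 (bd _ _)) /endpoint lL => /(_ erefl).
  by rewrite /parts => ->.
- have [v0 _] := loop_vertex; have := bc v0.
  rewrite (loop_normal_derivative _ e0) => /(congr1 (part b)).
  by rewrite part0 partB => /eqP; rewrite subr_eq0 => /eqP.
- by move=> e; rewrite (he0 e).
Qed.

(** Integrate u' * u' by parts: the boundary terms cancel by periodicity. *)
Lemma loop_energy (m : R) (u du : R -> R) :
  abs_cont 0 L u du -> abs_cont 0 L du (fun x => - m * u x) ->
  u L = u 0 -> du L = du 0 ->
  rint 0 L (fun x => du x ^+ 2) = m * rint 0 L (fun x => u x ^+ 2).
Proof.
move=> hu hdu uL duL; have L0 := ltW loop_length_gt0.
have := abs_cont_by_parts L0 hdu hu; rewrite uL duL subrr.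
have u2 := abs_cont_sq_integrable L0 hu; have du2 := abs_cont_sq_integrable L0 hdu.
rewrite (eq_rint (g := fun x => du x ^+ 2 - m * u x ^+ 2)); last by move=> x _; ring.
rewrite rintB; [|exact: du2.2|by apply: integrable_onZ; exact: u2.2].
rewrite rintZ; last exact: u2.2.
by move/eqP; rewrite subr_eq0 => /eqP.
Qed.

Lemma loop_eigenvector_lt0 (m : R) (F : gfun La) : m < 0 ->
  eigenvector T m F -> eqL2 F (fun _ _ => 0).
Proof.
move=> m0 /loop_eigenvectorE[u [du h]]; have L0 := ltW loop_length_gt0.
apply/eqL2P => e b; have [hu hdu uL duL Fu] := h b.
have E := loop_energy hu hdu uL duL.
have u2 := abs_cont_sq_integrable L0 hu.
have d0 : 0 <= rint 0 L (fun x => du b x ^+ 2) by apply: rint_ge0 => x _; exact: sqr_ge0.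
have : rint 0 L (fun x => u b x ^+ 2) <= 0 by rewrite E nmulr_rge0 in d0.
move=> /(rint_sqr_eq0 u2) u0.
rewrite (loop_len e).
by apply: filterS2 u0 (Fu e) => x h1 h2 xe; rewrite h2// h1// /parts part0.
Qed.

Lemma loop_eigenvector_eq0 (F : gfun La) : eigenvector T 0 F ->
  exists a : R[i], eqL2 F (fun _ _ => a).
Proof.
move=> /loop_eigenvectorE[u [du h]]; have L0 := ltW loop_length_gt0.
exists (u false 0 +i* u true 0); apply/eqL2P => e b; have [hu hdu uL duL Fu] := h b.
have E := loop_energy hu hdu uL duL; rewrite mul0r in E.
have du2 := abs_cont_sq_integrable L0 hdu.
have /(rint_sqr_eq0 du2) d0 : rint 0 L (fun x => du b x ^+ 2) <= 0 by rewrite E.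
rewrite (loop_len e); apply: filterS (Fu e) => x h1 xe; rewrite h1//.
have [di ->] := hu; last by have /andP[/ltW -> /ltW ->] := xe.
rewrite (rint_ae_eq (g := fun=> 0)).
- by rewrite rint0 addr0 /parts; case: (b).
- apply: integrable_on_measurable; apply: integrable_on_sub di => //.
  by have /andP[_ /ltW] := xe.
- by [].
apply: filterS d0 => y h2 /andP[y0 yx]; apply: h2.
by rewrite y0 (lt_trans yx)//; have /andP[] := xe.
Qed.

Lemma loop_multiplicity_lt0 (m : R) : m < 0 -> multiplicity T m = 0%E.
Proof.
move=> m0; apply/le_anti; rewrite multiplicity_ge0 andbT.
apply: (@multiplicity_le _ _ T m 0) => -[//|n] [F [eF indep]].
suff /(_ ord0)/eqP : forall i : 'I_n.+1, (i == ord0)%:R = 0 :> R[i].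
  by rewrite eqxx oner_eq0.
apply: (indep (fun i => (i == ord0)%:R)).
have := loop_eigenvector_lt0 m0 (eF ord0).
move=> h e; apply: filterS (h e) => x k xe.
rewrite (bigD1 ord0)//= mul1r k// big1 ?addr0// => i /negbTE ->.
by rewrite mul0r.
Qed.

Lemma loop_multiplicity0 : multiplicity T 0 = 1%E.
Proof.
have L0 := loop_length_gt0.
apply/le_anti/andP; split.
  apply: (@multiplicity_le _ _ T 0 1) => -[//|[//|n]] [F [eF indep]].
  have [a Fa] := choice (fun i => loop_eigenvector_eq0 (eF i)).
  have sum2 (c0 c1 : R[i]) : c0 * a ord0 + c1 * a (lift ord0 ord0) = 0 -> c0 = 0 /\ c1 = 0.
    move=> c01.
    pose c (i : 'I_n.+2) := if i == ord0 then c0 else if i == lift ord0 ord0 then c1 else 0.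
    suff h : forall i, c i = 0 by split; [exact: (h ord0)|exact: (h (lift ord0 ord0))].
    apply: indep => e; apply: filterS2 (Fa ord0 e) (Fa (lift ord0 ord0) e) => x h0 h1 xe.
    rewrite (bigD1 ord0)//= (bigD1 (lift ord0 ord0))//= big1 ?addr0; last first.
      by move=> i /andP[/negbTE i0 /negbTE i1]; rewrite /c i0 i1 mul0r.
    by rewrite h0// h1.
  have [_ /eqP] := sum2 (a (lift ord0 ord0)) (- a ord0) (ltac:(by rewrite mulNr mulrC subrr)).
  rewrite oppr_eq0 => /eqP a0.
  have [/eqP] := sum2 1 0 (ltac:(by rewrite a0 mulr0 mul0r addr0)).
  by rewrite oner_eq0.
apply: (multiplicity_ubound (n := 1)); exists (fun=> fun _ _ => (1 : R)%:C); split.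
  move=> _; apply: (@loop_eigenvector 0 (fun=> 1) (fun=> 0)) => //; first exact: abs_cont_cst.
  have := abs_cont_cst 0 L 0; apply: eq_abs_cont => //; first exact: ltW.
  by move=> x _; rewrite oppr0 mul0r.
move=> c c0 i; have [e0 _] := loop_edge.
have := c0 e0; rewrite loop_len => /(ae_on_witness L0)[x _].
by rewrite big_ord1 mulr1 (ord1 i).
Qed.

Lemma loop_multiplicity_pos (k : nat) : (0 < k)%N ->
  (2%:R%:E <= multiplicity T ((pi * k.*2%:R / L) ^+ 2))%E.
Proof.
move=> k0; have L0 := loop_length_gt0; set w := _ / _.
have wL : w * L = k.*2%:R * pi by rewrite /w divfK ?gt_eqF// mulrC.
have cL : cos (w * L) = 1 by rewrite wL cos_npi -mul2n exprM sqrrN !expr1n.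
have sL : sin (w * L) = 0 by rewrite wL sin_npi.
have w0 : 0 < w by rewrite /w divr_gt0// mulr_gt0 ?pi_gt0// ltr0n double_gt0.
have hc := abs_cont_cos w (ltW L0); have hs := abs_cont_sin w (ltW L0).
apply: multiplicity_ubound.
exists (fun (i : 'I_2) e x => (if i == ord0 then cos (w * x) else sin (w * x))%:C).
split=> [i|c c0].
  case: (i == ord0).
    apply: (@loop_eigenvector _ (fun x => cos (w * x)) (fun x => - w * sin (w * x))) => //.
    - have := abs_contZ (- w) hs; apply: eq_abs_cont => //; first exact: ltW.
      by move=> x _; ring.
    - by rewrite cL mulr0 cos0.
    - by rewrite sL !mulr0 sin0 mulr0.
  apply: (@loop_eigenvector _ (fun x => sin (w * x)) (fun x => w * cos (w * x))) => //.
  - have := abs_contZ w hc; apply: eq_abs_cont => //; first exact: ltW.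
    by move=> x _; ring.
  - by rewrite sL mulr0 sin0.
  - by rewrite cL mulr0 cos0.
have [e0 _] := loop_edge.
have E b x : 0 <= x <= L -> part b (c ord0) * cos (w * x) + part b (c ord_max) * sin (w * x) = 0.
  apply: (abs_cont_ae_eq0 L0 (abs_contD (abs_contZ _ hc) (abs_contZ _ hs))).
  have := c0 e0; rewrite loop_len; apply: filterS => {}x h xL.
  have := congr1 (part b) (h xL); rewrite big_ord_recl big_ord1 part0 partD/=.
  have -> : lift ord0 ord0 = ord_max :> 'I_2 by apply: val_inj.
  by rewrite ![_ * _%:C]mulrC !partZ => <-; ring.
have c00 : c ord0 = 0.
  apply: partP => b; have := E b 0; rewrite lexx ltW// => /(_ isT).
  by rewrite mulr0 cos0 sin0 mulr0 addr0 mulr1 part0.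
(* The sine is 1 at a quarter of the period. *)
have c10 : c ord_max = 0.
  apply: partP => b; have := E b (pi / 2 / w).
  have -> : w * (pi / 2 / w) = pi / 2 by rewrite mulrC divfK// gt_eqF.
  rewrite sin_pihalf mulr1 c00 !part0 mul0r add0r; apply.
  apply/andP; split; first by apply/ltW/divr_gt0 => //; apply: divr_gt0 => //; exact: pi_gt0.
  rewrite ler_pdivrMr// [L * w]mulrC wL.
  rewrite mulrC ler_pM2r ?pi_gt0//.
  apply: (@le_trans _ _ 1); last by rewrite ler1n double_gt0.
  by rewrite invf_le1// ler1n.
move=> i; case: (unliftP ord0 i) => [j ->|->//].
by rewrite (ord1 j) -c10; congr c; apply: val_inj.
Qed.

Lemma loop_positive_count (k : nat) (t : R) :
  (pi * k.*2%:R / L) ^+ 2 <= t ->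
  (k.*2%:R%:E <= eigenvalue_count T [set m | (0 < m)%R] t)%E.
Proof.
move=> kt; have L0 := loop_length_gt0.
pose ev (i : nat) : R := (pi * i.*2%:R / L) ^+ 2.
pose s := [seq ev i | i <- iota 1 k].
have evle i i' : (ev i <= ev i') = (i <= i')%N.
  rewrite /ev ler_pXn2r// ?nnegrE ?divr_ge0 ?mulr_ge0 ?pi_ge0// ?(ltW L0)//.
  by rewrite ler_pM2r ?invr_gt0// ler_pM2l ?pi_gt0// ler_nat leq_double.
have us : uniq s.
  rewrite map_inj_uniq ?iota_uniq// => i i' e; apply/eqP.
  by rewrite eqn_leq -!evle e lexx.
apply: esum_ge; exists [set` s].
  split; first exact: finite_seq.
  move=> _ /= /mapP[i /[!mem_iota] /andP[i1 ik] ->]; split.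
    by rewrite /ev exprn_gt0// divr_gt0// mulr_gt0 ?pi_gt0// ltr0n double_gt0.
  by apply: le_trans kt; rewrite -/(ev k) evle -ltnS addnC addn1 in ik *.
rewrite -fsbig_seq// big_map.
apply: (@le_trans _ _ (\sum_(i <- iota 1 k) 2%:R%:E)%E).
  rewrite sumEFin lee_fin -natr_sum ler_nat big_const_seq count_predT size_iota.
  by rewrite iter_addn_0 mul2n.
rewrite big_seq [leRHS]big_seq; apply: lee_sum => i /[!mem_iota] /andP[i1 _].
exact: loop_multiplicity_pos.
Qed.

(** The eigenvalue 0 is simple and negative numbers are not eigenvalues. *)
Lemma loop_count_all (t : R) :
  eigenvalue_count T setT t =
  if 0 <= t then (1 + eigenvalue_count T [set m | (0 < m)%R] t)%E else 0%E.
Proof.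
have mge m : (0 <= multiplicity T m)%E by exact: multiplicity_ge0.
case: ifPn => t0; last first.
  apply: esum1 => m [_ mt]; apply: loop_multiplicity_lt0.
  by rewrite (le_lt_trans mt)// ltNge.
rewrite /eigenvalue_count (esumID [set m | 0 < m])//; rewrite addeC; congr (_ + _)%E; last first.
  by congr (esum _ _); apply/seteqP; split => m /= ; tauto.
rewrite (esumID [set 0])//.
set A := [set m | setT m /\ m <= t] `&` _.
have -> : A `&` [set 0] = [set 0].
  apply/seteqP; split => m /=; first by case.
  by move=> ->; split => //; split => //=; rewrite ltxx.
rewrite esum_set1// loop_multiplicity0 esum1 ?adde0// => m /= [[_ /negP]].
rewrite -leNgt le_eqVlt => /predU1P[->//|m0 _]; exact: loop_multiplicity_lt0.
Qed.

End LoopSpectrum.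

Theorem theorem5p5 (R : realType) (Gamma Lambda : metric_graph R)
    (hconn : connected_graph Gamma)
    (hloop : is_loop Lambda)
    (hlen : total_length Lambda = total_length Gamma)
    (j : nat) (hj : (0 < j)%N) :
  (nth_positive_eigenvalue (krein_laplacian Gamma) j >=
     nth_positive_eigenvalue (standard_laplacian Lambda) j)%E /\
  nth_positive_eigenvalue (standard_laplacian Lambda) j =
    nth_eigenvalue (standard_laplacian Lambda) j.+1.
Proof.
split.
  apply: le_ereal_inf_tmp => _ [t jt <-].
  apply: ereal_inf_lbound; exists t => //.
  (* The j-th positive eigenvalue of the loop is (2 pi k / L) ^ 2 for k = ceil (j / 2). *)
  have [k k0 /andP[jk kj]] : exists2 k, (0 < k)%N & (j <= k.*2)%N && (k.*2.-1 <= j)%N.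
    by exists (uphalf j); lia.
  case: j hj jt jk kj => // j _ jt jk kj.
  have [I [F [lam [jI eF lamP free]]]] := eigenvalue_count_family jt.
  have := krein_bound eF (fun i => (lamP i).1) (fun i => (lamP i).2) free k0 (leq_trans kj jI).
  rewrite -hlen => /(loop_positive_count hloop); apply: le_trans.
  by rewrite lee_fin ler_nat.
congr ereal_inf; apply/seteqP; split => _ [t /= jt <-]; exists t => //=.
  rewrite loop_count_all//; case: ifPn => t0.
    by rewrite -addn1 addnC natrD EFinD leeD2l.
  move: jt; rewrite /eigenvalue_count.
  rewrite (_ : [set m | _ /\ _] = set0) ?esum_set0.
    by rewrite lee_fin lern0 => /eqP j0; rewrite j0 in hj.
  apply/seteqP; split => // m /= [m0 mt].
  by move: t0; rewrite (le_trans (ltW m0) mt).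
move: jt; rewrite loop_count_all//; case: ifPn => t0.
  by rewrite -addn1 addnC natrD EFinD leeD2lE.
by rewrite lee_fin lern0.
Qed.
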